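(* Let $N\ge1$. Let $D_k$ ($k\ge0$) be the normalized one-row Capelli elements and $c_{2r-1}$ ($r\ge1$) Sergeev's odd cyclic elements in $Z(\mathrm U(\mathfrak q_N))$. For every $p\ge1$, $$D_{2p}\in\mathbb Q[D_1,D_3,\dots,D_{2p-1}],$$ $$c_{2p-1}=(2p-1)D_{2p-1}+P_p(D_1,D_3,\dots,D_{2p-3})$$ for a polynomial $P_p$ with rational coefficients. Consequently, for every $p\ge1$, $$\mathbb C[c_1,c_3,\dots,c_{2p-1}]=\mathbb C[D_1,D_3,\dots,D_{2p-1}].$$ Thus the two odd-indexed families are related by a triangular change of algebra generators with respect to increasing index.
   Context: Ground field $\mathbb C$. Queer Lie superalgebra: fix $N\ge1$, $I_N=\{-N,\dots,-1,1,\dots,N\}$, $\bar i=0$ if $i>0$ and $\bar i=1$ if $i<0$. Let $E_{ij}$ ($i,j\in I_N$) be the matrix units of $\mathfrak{gl}(N|N)$, of parity $\bar i+\bar j$ mod $2$. $\mathfrak q_N\subset\mathfrak{gl}(N|N)$ is the Lie sub-superalgebra spanned by $F_{ij}=E_{ij}+E_{-i,-j}$ (so $F_{-i,-j}=F_{ij}$). $\mathrm U(\mathfrak q_N)$ is its universal enveloping algebra and $Z_N=Z(\mathrm U(\mathfrak q_N))$ its center (in the superalgebra sense; all central elements are even). Square brackets such as $\mathbb Q[D_1,D_3,\dots]$ denote the subalgebra of $Z_N$ generated over the indicated field by the listed elements (no algebraic independence is asserted). Harish-Chandra map: $\mathfrak h_{\bar0}=\bigoplus_{i=1}^N\mathbb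 C F_{ii}$, $\mathfrak h_{\bar 1}=\bigoplus_{i=1}^N\mathbb C F_{i,-i}$, $\mathfrak n_+$ (resp. $\mathfrak n_-$) is the span of $F_{ij},F_{i,-j}$ with $1\le i<j\le N$ (resp. $1\le j<i\le N$). For $z\in Z_N$, $\mathrm{HC}(z)\in\mathbb C[\lambda_1,\dots,\lambda_N]$ is the polynomial with $z\equiv \mathrm{HC}(z)|_{\lambda_i=F_{ii}}$ modulo $\mathfrak n_-\mathrm U(\mathfrak q_N)+\mathrm U(\mathfrak q_N)\mathfrak n_+$ (no $\rho$-shift). It is known that $\mathrm{HC}$ is an algebra isomorphism of $Z_N$ onto $\Gamma_N$, the algebra of symmetric polynomials $f\in\mathbb C[\lambda_1,\dots,\lambda_N]$ such that $f(t,-t,\lambda_3,\dots,\lambda_N)$ is independent of $t$ (no condition if $N=1$). Cyclic elements: for $r\ge1$, $$c_r=\sum_{i_1,\dots,i_r\in I_N}(-1)^{\bar i_2+\cdots+\bar i_r}F_{i_1i_2}F_{i_2i_3}\cdots F_{i_ri_1}\in \mathrm U(\mathfrak q_N);$$ these are known to be central. Normalized one-row Capelli elements: $(u\downarrow r)=u(u-1)\cdots(u-r+1)$, $(u\downarrow0)=1$. Let $Q^-_{(0)}=1$ and for $r\ge1$ let $Q^-_{(r)}\in\Gamma_N$ be the one-row factorial Schur $Q$-polynomial $Q^-_{(r)}(\lambda)=2\sum_{i=1}^N(\lambda_i\downarrow r)\prod_{j\ne i}\frac{\lambda_i+\lambda_j}{\lambda_i-\lambda_j}$; equivalently $\sum_{r\ge0}Q^-_{(r)}(\lambda)/(u\downarrow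 r)=\prod_{i=1}^N\frac{u+1+\lambda_i}{u+1-\lambda_i}$ as series in $u^{-1}$. Then $D_0=1$ and $D_r=\frac1{r!}C_{(r)}$ for $r\ge1$, where $C_{(r)}$ is Nazarov's Capelli element of the one-row strict partition $(r)$; $D_r$ is the unique element of $Z_N$ with $\mathrm{HC}(D_r)=Q^-_{(r)}$. *)

(* Defs.v *)
From HB Require Import structures.
From mathcomp Require Import all_boot all_order all_algebra.
From mathcomp Require Import fraction generic_quotient ring_quotient.
From mathcomp Require Import boolp reals complex.
From mathcomp Require finmap.
From mathcomp Require Import monalg mpoly.

Set Implicit Arguments.
Unset Strict Implicit.
Unset Printing Implicit Defensive.

Import GRing.Theory.
Local Open Scope ring_scope.

(* Both monalg and mpoly declare this notation; take the one of mpoly. *)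
Notation "{ 'mpoly' T [ n ] }" := (mpoly n T) : type_scope.

(* The index set I_N is 'I_(N + N): for i : 'I_N, [lshift N i] stands for the  *)
(* positive index i + 1 and [rshift N i] for the negative index -(i + 1).     *)
Section Indices.
Variable N : nat.

Definition pos (i : 'I_N) : 'I_(N + N) := lshift N i.

Definition neg (i : 'I_(N + N)) : 'I_(N + N) :=
  match split i with inl a => rshift N a | inr a => lshift N a end.

Definition par (i : 'I_(N + N)) : bool := (N <= i)%N.

End Indices.

Section QueerLieSuperalgebra.
Variables (K : fieldType) (N : nat).
Notation gl := 'M[K]_(N + N).

Definition Fmx (i j : 'I_(N + N)) : gl :=
  delta_mx i j + delta_mx (neg i) (neg j).

Definition queer : {vspace gl} := (\sum_i \sum_j <[Fmx i j]>)%VS.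

(* [a] is the parity: false for even, true for odd. *)
Definition homogeneous (a : bool) (X : gl) : Prop :=
  forall i j, par i (+) par j != a -> X i j = 0.

Definition superbracket (a b : bool) (X Y : gl) : gl :=
  X *m Y - (-1) ^+ (a && b) *: (Y *m X).

Lemma neg_lshift (i : 'I_N) : neg (lshift N i) = rshift N i.
Proof. by rewrite /neg -[lshift N i]/(unsplit (inl i)) unsplitK. Qed.

Lemma neg_rshift (i : 'I_N) : neg (rshift N i) = lshift N i.
Proof. by rewrite /neg -[rshift N i]/(unsplit (inr i)) unsplitK. Qed.

Lemma negK : involutive (@neg N).
Proof.
by move=> i; rewrite -(splitK i); case: (split i) => k /=;
  rewrite ?neg_lshift ?neg_rshift ?neg_lshift.
Qed.

Lemma Fmx_queer i j : Fmx i j \in queer.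
Proof.
by rewrite /queer (bigD1 i) //= (bigD1 j) //= -addvA memvE addvSl.
Qed.

Lemma queerP (X : gl) :
  reflect (forall i j, X (neg i) (neg j) = X i j) (X \in queer).
Proof.
apply: (iffP idP) => [/memv_sumP[v vP ->] i j|qX].
  rewrite !summxE; apply: eq_bigr => k _.
  have /memv_sumP[w wP ->] := vP k isT.
  rewrite !summxE; apply: eq_bigr => l _.
  have /vlineP[c ->] := wP l isT.
  by rewrite /Fmx !mxE !(can_eq negK) !(can2_eq negK negK) addrC.
have -> : X = \sum_(i < N) \sum_j X (lshift N i) j *: Fmx (lshift N i) j.
  rewrite [LHS]matrix_sum_delta big_split_ord /= -big_split /=.
  apply: eq_bigr => i _.
  rewrite [X in _ + X](reindex_inj (can_inj negK)) /= -big_split /=.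
  apply: eq_bigr => j _.
  by rewrite -neg_lshift qX -scalerDr.
by apply: memv_suml => i _; apply: memv_suml => j _; apply: memvZ;
  exact: Fmx_queer.
Qed.

Lemma superbracket_queer a b (X Y : gl) :
  X \in queer -> Y \in queer -> superbracket a b X Y \in queer.
Proof.
move=> /queerP qX /queerP qY; apply/queerP => i j; rewrite !mxE.
by congr (_ - _ * _); rewrite (reindex_inj (can_inj negK));
   apply: eq_bigr => k _; rewrite qX qY.
Qed.

End QueerLieSuperalgebra.

Notation qN K N := (subvs_of (queer K N)).

(* U(q_N) is the free associative algebra on the elements of q_N, modulo the  *)
(* two-sided ideal expressing that the generators depend linearly on q_N and  *)
(* that supercommutators are given by the bracket.                            *)
Section EnvelopingAlgebra.
Variables (K : fieldType) (N : nat).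

Notation freealg := {malg K[{fmonom (qN K N)}]}.

Definition fgen (X : qN K N) : freealg :=
  << fmu X >>.

Inductive Uideal : freealg -> Prop :=
| Uideal0 : Uideal 0
| UidealD x y : Uideal x -> Uideal y -> Uideal (x + y)
| UidealM a x b : Uideal x -> Uideal (a * x * b)
| Uideal_linear c X Y :
    Uideal (fgen (c *: X + Y) - (c *: fgen X + fgen Y))
| Uideal_bracket a b X Y Z :
    homogeneous a (vsval X) -> homogeneous b (vsval Y) ->
    vsval Z = superbracket a b (vsval X) (vsval Y) ->
    Uideal (fgen X * fgen Y - (-1) ^+ (a && b) * (fgen Y * fgen X) - fgen Z).

Definition Uideal_pred : {pred freealg} := fun x => `[< Uideal x >].

Lemma UidealP x : reflect (Uideal x) (x \in Uideal_pred).
Proof. exact: asboolP. Qed.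

Lemma Uideal_zmod_closed : zmod_closed Uideal_pred.
Proof.
split=> [|x y /UidealP Ix /UidealP Iy]; apply/UidealP; first exact: Uideal0.
apply: UidealD Ix _.
by have := UidealM (-1) 1 Iy; rewrite mulr1 mulN1r.
Qed.

HB.instance Definition _ :=
  GRing.isZmodClosed.Build freealg Uideal_pred Uideal_zmod_closed.

Definition Uq := Quotient.quot Uideal_pred.

HB.instance Definition _ := GRing.Zmodule.on Uq.

Local Open Scope quotient_scope.

Definition Upi (x : freealg) : Uq := \pi_Uq x.

Lemma Upi_eq x y : Uideal (x - y) -> Upi x = Upi y.
Proof.
by move=> Ixy; apply/eqP; rewrite -Quotient.idealrBE; apply/UidealP.
Qed.

Lemma Uideal_repr x : Uideal (repr (Upi x) - x).
Proof.
by apply/UidealP; rewrite Quotient.idealrBE /Upi reprK.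
Qed.

Lemma Upi_repr (u : Uq) : Upi (repr u) = u.
Proof. exact: reprK. Qed.

Definition Uone : Uq := Upi 1.
Definition Umul (u v : Uq) : Uq := Upi (repr u * repr v).
Definition Uscale (c : K) (u : Uq) : Uq := Upi (c *: repr u).

Lemma UpiM x y : Umul (Upi x) (Upi y) = Upi (x * y).
Proof.
apply: Upi_eq; set x' := repr _; set y' := repr _.
have -> : x' * y' - x * y = 1 * (x' - x) * y' + x * (y' - y) * 1.
  by rewrite mul1r mulr1 mulrBl mulrBr addrA addrNK.
by apply: UidealD; apply: UidealM; exact: Uideal_repr.
Qed.

Lemma UpiZ c x : Uscale c (Upi x) = Upi (c *: x).
Proof.
apply: Upi_eq; rewrite -scalerBr -[X in c *: X]mul1r scalerAl -[_ * _]mulr1.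
by apply: UidealM; exact: Uideal_repr.
Qed.

Lemma UpiD x y : Upi (x + y) = Upi x + Upi y.
Proof. by rewrite /Upi; rewrite !piE. Qed.

Lemma UmulA : associative Umul.
Proof.
by move=> u v w; rewrite -[u]Upi_repr -[v]Upi_repr -[w]Upi_repr !UpiM mulrA.
Qed.

Lemma Umul1r : left_id Uone Umul.
Proof. by move=> u; rewrite -[u]Upi_repr UpiM mul1r. Qed.

Lemma Umulr1 : right_id Uone Umul.
Proof. by move=> u; rewrite -[u]Upi_repr UpiM mulr1. Qed.

Lemma UmulDl : left_distributive Umul +%R.
Proof.
move=> u v w; rewrite -[u]Upi_repr -[v]Upi_repr -[w]Upi_repr.
by rewrite -UpiD !UpiM mulrDl UpiD.
Qed.

Lemma UmulDr : right_distributive Umul +%R.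
Proof.
move=> u v w; rewrite -[u]Upi_repr -[v]Upi_repr -[w]Upi_repr.
by rewrite -UpiD !UpiM mulrDr UpiD.
Qed.

(* Elements of the ideal have no constant term, so U(q_N) is nonzero. *)
Lemma Uideal_const x : Uideal x -> monalg.mcoeff mone x = 0.
Proof.
have gen0 X : monalg.mcoeff mone (fgen X) = 0.
  by rewrite /fgen monalg.mcoeffU1 fm1_eq1.
elim=> {x} [|x y _ Ix _ Iy|a x b _ Ix|c X Y|a b X Y Z _ _ _].
- exact: raddf0.
- by rewrite raddfD /= Ix Iy addr0.
- by rewrite !rmorphM /= Ix mulr0 mul0r.
- by rewrite raddfB /= raddfD /= monalg.mcoeffZ !gen0 mulr0 addr0 subr0.
- by rewrite !raddfB /= !rmorphM /= !gen0 !mulr0 !subr0.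
Qed.

Lemma Uone_neq0 : Uone != 0.
Proof.
have -> : (0 : Uq) = Upi 0 by rewrite /Upi !piE.
rewrite /Uone /Upi -Quotient.idealrBE subr0; apply/negP => /UidealP/Uideal_const.
by rewrite rmorph1 => /eqP; rewrite oner_eq0.
Qed.

HB.instance Definition _ := GRing.Zmodule_isNzRing.Build Uq
  UmulA Umul1r Umulr1 UmulDl UmulDr Uone_neq0.

Lemma UscaleA c d u : Uscale c (Uscale d u) = Uscale (c * d) u.
Proof. by rewrite -[u]Upi_repr !UpiZ scalerA. Qed.

Lemma Uscale1 : left_id 1 Uscale.
Proof. by move=> u; rewrite -[u]Upi_repr UpiZ scale1r. Qed.

Lemma UscaleDr : right_distributive Uscale +%R.
Proof.
move=> c u v; rewrite -[u]Upi_repr -[v]Upi_repr -UpiD !UpiZ.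
by rewrite scalerDr UpiD.
Qed.

Lemma UscaleDl u : {morph Uscale^~ u : c d / c + d}.
Proof. by move=> c d; rewrite -[u]Upi_repr !UpiZ scalerDl UpiD. Qed.

HB.instance Definition _ := GRing.Zmodule_isLmodule.Build K Uq
  UscaleA Uscale1 UscaleDr UscaleDl.

Lemma UscaleAl (c : K) (u v : Uq) : c *: (u * v) = (c *: u) * v.
Proof.
change (Uscale c (Umul u v) = Umul (Uscale c u) v).
by rewrite -[u]Upi_repr -[v]Upi_repr !(UpiM, UpiZ) scalerAl.
Qed.

HB.instance Definition _ := GRing.Lmodule_isLalgebra.Build K Uq UscaleAl.

Lemma freealg_scaleAr (c : K) (x y : freealg) : c *: (x * y) = x * (c *: y).
Proof.
apply/malgP=> k; rewrite monalg.mcoeffZ.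
rewrite (mcoeffMlw _ (finmap.fsubset_refl (monalg.msupp x)) (finmap.fsubset_refl _)).
rewrite (mcoeffMlw _ (finmap.fsubset_refl (monalg.msupp x)) (monalg.msuppZ_le c y)).
rewrite big_distrr; apply: eq_bigr => k1 _.
rewrite big_distrr; apply: eq_bigr => k2 _.
by rewrite monalg.mcoeffZ /= mulrnAr mulrCA.
Qed.

Lemma UscaleAr (c : K) (u v : Uq) : c *: (u * v) = u * (c *: v).
Proof.
change (Uscale c (Umul u v) = Umul u (Uscale c v)).
by rewrite -[u]Upi_repr -[v]Upi_repr !(UpiM, UpiZ) freealg_scaleAr.
Qed.

HB.instance Definition _ := GRing.Lalgebra_isAlgebra.Build K Uq UscaleAr.

End EnvelopingAlgebra.

Section UqDefinitions.
Variables (K : fieldType) (N : nat).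
Notation U := (Uq K N).

Definition Uiota (X : qN K N) : U := Upi (fgen X).

Definition Fgen (i j : 'I_(N + N)) : U := Uiota (vsproj (queer K N) (Fmx K i j)).

(* [Uparity a u]: u is homogeneous of parity a for the Z/2-grading of U(q_N)  *)
(* induced by that of q_N.                                                    *)
Inductive Uparity : bool -> U -> Prop :=
| Uparity_scalar c : Uparity false c%:A
| Uparity_iota a X : homogeneous a (vsval X) -> Uparity a (Uiota X)
| UparityD a u v : Uparity a u -> Uparity a v -> Uparity a (u + v)
| UparityM a b u v : Uparity a u -> Uparity b v -> Uparity (a (+) b) (u * v).

Definition homogeneous_central (a : bool) (z : U) : Prop :=
  Uparity a z /\
  forall b u, Uparity b u -> z * u = (-1) ^+ (a && b) * (u * z).

(* The supercenter is the sum of its homogeneous components.                  *)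
Definition central (z : U) : Prop :=
  exists z0 z1, [/\ homogeneous_central false z0,
                    homogeneous_central true z1 & z = z0 + z1].

(* n_- U + U n_+ *)
Inductive HCideal : U -> Prop :=
| HCideal0 : HCideal 0
| HCidealD u v : HCideal u -> HCideal v -> HCideal (u + v)
| HCideal_lower0 (i j : 'I_N) u :
    (j < i)%N -> HCideal (Fgen (pos i) (pos j) * u)
| HCideal_lower1 (i j : 'I_N) u :
    (j < i)%N -> HCideal (Fgen (pos i) (neg (pos j)) * u)
| HCideal_upper0 (i j : 'I_N) u :
    (i < j)%N -> HCideal (u * Fgen (pos i) (pos j))
| HCideal_upper1 (i j : 'I_N) u :
    (i < j)%N -> HCideal (u * Fgen (pos i) (neg (pos j))).

(* [HC z f] means HC(z) = f: z is congruent to f(F_11, ..., F_NN), where the  *)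
(* variable 'X_i of f is lambda_(i+1). The images of the F_ii commute.        *)
Definition HC (z : U) (f : {mpoly K[N]}) : Prop :=
  HCideal (z - mmap (in_alg U) (fun i => Fgen (pos i) (pos i)) f).

(* The index i_(k+1) is [i k], and [ordS] is the cyclic successor on 'I_r.    *)
Definition cyclic_elt (r : nat) : U :=
  \sum_(i : {ffun 'I_r -> 'I_(N + N)})
    (-1) ^+ (\sum_(k < r | k != 0%N :> nat) par (i k))
    * \prod_(k < r) Fgen (i k) (i (ordS k)).

Definition fallingX (i : 'I_N) (r : nat) : {mpoly K[N]} :=
  \prod_(k < r) ('X_i - k%:R).

(* [onerowQ r q] means that q is the polynomial Q^-_(r); the sum is an        *)
(* identity of rational functions in the lambda_i.                            *)
Definition onerowQ (r : nat) (q : {mpoly K[N]}) : Prop :=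
  if r is 0 then q = 1 else
  tofrac q = 2 * \sum_(i < N) tofrac (fallingX i r) *
    \prod_(j < N | j != i)
      (tofrac ('X_i + 'X_j) / tofrac ('X_i - 'X_j))
  :> {fraction {mpoly K[N]}}.

Definition is_capelli (r : nat) (z : U) : Prop :=
  central z /\ exists2 q, onerowQ r q & HC z q.

(* The k-subalgebra generated by S, scalars acting through phi : k -> K.      *)
Inductive subalg (k : fieldType) (phi : {rmorphism k -> K}) (S : U -> Prop) :
    U -> Prop :=
| subalg_scalar c : subalg phi S (phi c)%:A
| subalg_gen u : S u -> subalg phi S u
| subalgD u v : subalg phi S u -> subalg phi S v -> subalg phi S (u + v)
| subalgM u v : subalg phi S u -> subalg phi S v -> subalg phi S (u * v).

(* [oddupto p x] is the set {x_1, x_3, ..., x_(2p-1)}.                        *)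
Definition oddupto (p : nat) (x : nat -> U) : U -> Prop :=
  fun u => exists2 i, (i < p)%N & u = x i.*2.+1.

End UqDefinitions.

(* Main.v *)
(* The uniqueness half of [hD] makes a central element determined by any of its
   HC values, so the theorem reduces to identities in C[lambda].  HC is
   multiplicative on the center without PBW: n_- U + U n_+ is stable under left
   multiplication by central elements and by polynomials in the F_ii.

   Modulo U n_+ the diagonal entries x_a of the odd twisted powers of the matrix
   (F_ij) obey the triangular recursion
     x_a^(m+1) = lam_a (lam_a - 1) x_a^(m) - 2 lam_a sum_(b > a) x_b^(m),
   whence, with y = x (x - 1) and q(x) = prod_i (x + lam_i) / (x - lam_i),
     1 - sum_m HC(c_(2m+1)) / y^(m+1) = q(x) / q(x - 1).
   The coefficients of q in 1 / x are the Schur Q-functions, unitriangular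
   integer (Stirling) combinations of the factorial ones.  The relation
   q(x) q(-x) = 1 eliminates the even Q-functions, and the coefficient of
   x^(-2p) in q(x - 1) - q(x) = q(x - 1) sum_m HC(c_(2m+1)) / y^(m+1) has
   c_(2p-1) on the right and (2p-1) D_(2p-1) on the left as its top terms. *)

From HB Require Import structures.
From mathcomp Require Import all_boot all_order all_algebra.
From mathcomp Require Import monalg.
Require Import Defs.
From mathcomp Require Import ring zify.
From mathcomp Require Import fraction boolp reals complex mpoly.

Set Implicit Arguments.
Unset Strict Implicit.
Unset Printing Implicit Defensive.

Import GRing.Theory.
Local Open Scope ring_scope.

(** * Power series modulo X^n *)

Section TruncatedSeries.
Variables (F : fieldType) (n : nat).
Implicit Types p q r u : {poly F}.

Definition eqmodX p q := 'X^n %| p - q.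

Lemma eqmodX_refl p : eqmodX p p.
Proof. by rewrite /eqmodX subrr dvdp0. Qed.

Lemma eq_eqmodX p q : p = q -> eqmodX p q.
Proof. by move=> ->; exact: eqmodX_refl. Qed.

Lemma eqmodX_sym p q : eqmodX p q -> eqmodX q p.
Proof. by rewrite /eqmodX -dvdpNr opprB. Qed.

Lemma eqmodX_trans q p r : eqmodX p q -> eqmodX q r -> eqmodX p r.
Proof. by move=> pq qr; rewrite /eqmodX -(subrKA q) dvdp_add. Qed.

Lemma eqmodXD p p' q q' : eqmodX p p' -> eqmodX q q' -> eqmodX (p + q) (p' + q').
Proof. by move=> pp' qq'; rewrite /eqmodX opprD addrACA dvdp_add. Qed.

Lemma eqmodXB p p' q q' : eqmodX p p' -> eqmodX q q' -> eqmodX (p - q) (p' - q').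
Proof.
move=> pp' qq'; rewrite /eqmodX.
have -> : p - q - (p' - q') = (p - p') - (q - q') by ring.
by rewrite dvdp_sub.
Qed.

Lemma eqmodXM p p' q q' : eqmodX p p' -> eqmodX q q' -> eqmodX (p * q) (p' * q').
Proof.
move=> pp' qq'; rewrite /eqmodX.
have -> : p * q - p' * q' = (p - p') * q + (q - q') * p' by ring.
by rewrite dvdp_add ?dvdp_mulr.
Qed.

Lemma eqmodX_sum (I : Type) (s : seq I) (P : pred I) (f g : I -> {poly F}) :
  (forall i, P i -> eqmodX (f i) (g i)) ->
  eqmodX (\sum_(i <- s | P i) f i) (\sum_(i <- s | P i) g i).
Proof.
move=> fg; elim/big_ind2: _ => // [|p p' q q' pp' qq'].
  exact: eqmodX_refl.
exact: eqmodXD pp' qq'.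
Qed.

Lemma eqmodX_prod (I : Type) (s : seq I) (P : pred I) (f g : I -> {poly F}) :
  (forall i, P i -> eqmodX (f i) (g i)) ->
  eqmodX (\prod_(i <- s | P i) f i) (\prod_(i <- s | P i) g i).
Proof.
move=> fg; elim/big_ind2: _ => // [|p p' q q' pp' qq'].
  exact: eqmodX_refl.
exact: eqmodXM pp' qq'.
Qed.

(** The [n]-th power of ['X * u] is still divisible by ['X^n]. This serves both the sign change of
    the variable and the shift from [x] to [x - 1]. *)
Lemma eqmodX_comp p q u : eqmodX p q -> eqmodX (p \Po ('X * u)) (q \Po ('X * u)).
Proof.
move=> /dvdpP[r E]; rewrite /eqmodX -comp_polyB E comp_polyM rmorphXn /= comp_polyX exprMn.
by rewrite dvdp_mull // dvdp_mulr.
Qed.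

Lemma eqmodX_cancel u p q : u.[0] != 0 -> eqmodX (p * u) (q * u) -> eqmodX p q.
Proof.
move=> u0; rewrite /eqmodX -mulrBl Gauss_dvdpl //.
by rewrite coprimep_expl // coprimep_sym coprimepX rootE.
Qed.

Lemma eqmodX_coef p q k : eqmodX p q -> (k < n)%N -> p`_k = q`_k.
Proof.
move=> /dvdpP[r E] kn; apply/eqP; rewrite -subr_eq0 -coefB E coefMXn kn.
exact: eqxx.
Qed.

Lemma coef_eqmodX p q : (forall k, (k < n)%N -> p`_k = q`_k) -> eqmodX p q.
Proof.
move=> pq; rewrite /eqmodX -(poly_take_drop n (p - q)).
suff -> : take_poly n (p - q) = 0 by rewrite add0r dvdp_mull.
apply/polyP=> k; rewrite coef_take_poly coef0.
by case: ifP => // kn; rewrite coefB pq ?subrr.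
Qed.

Definition geomX (c : F) : {poly F} := \poly_(k < n) c ^+ k.

Lemma geomXP c : eqmodX ((1 - c *: 'X) * geomX c) 1.
Proof.
rewrite /eqmodX /geomX poly_def.
under eq_bigr do rewrite -exprZn.
have -> : (1 - c *: 'X) * (\sum_(i < n) (c *: 'X) ^+ i) - 1 = - (c ^+ n *: 'X^n).
  by rewrite -exprZn -[1 - _]opprB mulNr -subrX1 opprB addrAC subrr add0r.
by rewrite dvdpNr -mul_polyC dvdp_mull.
Qed.

End TruncatedSeries.

(** * Schur Q-functions and their factorial analogues *)

Fixpoint stirling2 (k r : nat) : nat :=
  match k, r with
  | 0, 0 => 1
  | k'.+1, r'.+1 => stirling2 k' r' + r'.+1 * stirling2 k' r'.+1
  | _, _ => 0
  end.

Lemma stirling2_small k r : (k < r)%N -> stirling2 k r = 0%N.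
Proof.
elim: k r => [|k IHk] [|r] //= kr.
by rewrite !IHk ?muln0 // ltnW.
Qed.

Lemma stirling2_diag k : stirling2 k k = 1%N.
Proof. by elim: k => //= k ->; rewrite stirling2_small // muln0. Qed.

(** Writing [x = (x - r) + r], multiplication by [x] sends a falling factorial to the next one plus
    [r] times itself, which is the Stirling recurrence. *)
Lemma expr_falling (A : comNzRingType) (x : A) k :
  x ^+ k = \sum_(r < k.+1) (stirling2 k r)%:R * \prod_(j < r) (x - j%:R).
Proof.
elim: k => [|k IHk]; first by rewrite big_ord1 big_ord0 mulr1.
rewrite big_ord_recl /= mul0r add0r exprS IHk mulr_sumr.
pose f r := (stirling2 k r * r)%:R * \prod_(j < r) (x - j%:R).
transitivity (\sum_(r < k.+1)
    ((stirling2 k r)%:R * \prod_(j < r.+1) (x - j%:R) + f r)).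
  apply: eq_bigr => r _; rewrite big_ord_recr /= /f natrM; ring.
rewrite big_split /= [X in _ + X](_ : _ = \sum_(r < k.+1) f r.+1); last first.
  rewrite big_ord_recl big_ord_recr /= /f muln0 mul0r add0r.
  by rewrite stirling2_small // mul0r addr0.
rewrite -big_split /=; apply: eq_bigr => r _.
by rewrite /f /bump /= add1n natrD mulrDl [(r.+1 * _)%N]mulnC.
Qed.

Section SchurQFunctions.
Variables (F : fieldType) (N : nat) (lam : 'I_N -> F).

Definition schur_weight (i : 'I_N) : F :=
  \prod_(j < N | j != i) ((lam i + lam j) / (lam i - lam j)).

Definition factorial_schurQ (r : nat) : F :=
  if r is 0 then 1 else
  2 * \sum_(i < N) (\prod_(k < r) (lam i - k%:R)) * schur_weight i.

(** The classical one-row Schur Q-function: powers replace falling factorials, so that its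
    generating series becomes a product over [i]. *)
Definition schurQ (r : nat) : F :=
  if r is 0 then 1 else 2 * \sum_(i < N) lam i ^+ r * schur_weight i.

Lemma schurQ_factorial k :
  schurQ k = \sum_(r < k.+1) (stirling2 k r)%:R * factorial_schurQ r.
Proof.
case: k => [|k]; first by rewrite big_ord1 mulr1.
rewrite big_ord_recl /= mul0r add0r.
under [RHS]eq_bigr do rewrite mulrCA mulr_sumr.
rewrite -mulr_sumr exchange_big /=; congr (_ * _); apply: eq_bigr => i _.
rewrite expr_falling big_ord_recl /= mul0r add0r mulr_suml.
by apply: eq_bigr => r _; rewrite mulrA.
Qed.

Lemma schurQ_top k :
  schurQ k = factorial_schurQ k
             + \sum_(r < k) (stirling2 k r)%:R * factorial_schurQ r.
Proof. by rewrite schurQ_factorial big_ord_recr /= stirling2_diag mul1r addrC. Qed.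

Hypothesis lam_inj : injective lam.
Hypothesis lam_neq0 : forall i, lam i != 0.

(* Lagrange interpolation at [0] and at the [1 / lam i]. *)
Lemma schur_partial_fractions :
  \prod_(j < N) (1 - lam j *: 'X)
  + \sum_(i < N) (2 * lam i * schur_weight i) *: 'X
      * \prod_(j < N | j != i) (1 - lam j *: 'X)
  = \prod_(j < N) (1 + lam j *: 'X).
Proof.
have size1 (c : F) : (size (1 + c *: 'X : {poly F})%R <= 2)%N.
  by rewrite addrC -mul_polyC -polyC1 size_MXaddC; case: ifP => // _;
    rewrite ltnS size_polyC; case: (_ != _).
have size1N (c : F) : (size (1 - c *: 'X : {poly F})%R <= 2)%N by rewrite -scaleNr.
have size_prod (P : pred 'I_N) (g : 'I_N -> {poly F}) :
    (forall i, size (g i) <= 2)%N -> (size (\prod_(i | P i) g i)%R <= #|P|.+1)%N.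
  move=> g2; apply: leq_trans (size_prod_leq _ _) _.
  rewrite leq_subLR addnS ltnS addnn -muln2 -sum1_card big_distrl /=.
  by apply: leq_sum => i _.
(* [d] has degree at most [N], yet vanishes at the [N + 1] distinct points [0] and [1 / lam i]. *)
apply/eqP; rewrite -subr_eq0; set d := _ - _; apply/negPn/negP => d0.
have roots0 : root d 0.
  rewrite rootE /d !hornerE horner_sum !horner_prod.
  rewrite big1 => [|i _]; last by rewrite !hornerE ?mulr0 ?subr0.
  rewrite [X in _ + X - _]big1 ?addr0 => [|i _]; last by rewrite !hornerE ?mulr0 ?mul0r.
  by rewrite big1 ?subrr // => i _; rewrite !hornerE ?mulr0 ?addr0.
have rootsV i : root d (lam i)^-1.
  rewrite rootE /d !hornerE horner_sum !horner_prod.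
  rewrite (bigD1 i) //= !hornerE divff // subrr mul0r add0r.
  (* At [1 / lam i] only the [i]-th term of the sum survives. The denominators of its weight cancel
     against the remaining product, and its [2] is the factor [j = i] of the right-hand side. *)
  rewrite (bigD1 i) //= [X in _ + X - _]big1 ?addr0; last first.
    move=> j ji; rewrite !hornerE horner_prod (bigD1 i) ?[i == j]eq_sym //=.
    by rewrite !hornerE divff // subrr /= mulr0 mul0r.
  rewrite [X in _ - X](bigD1 i) //= !hornerE horner_prod /=.
  have li := lam_neq0 i.
  have -> : 2 * lam i * schur_weight i / lam i = 2 * schur_weight i by field.
  rewrite divff // -[1 + 1]/(2 : F).
  rewrite -mulrA -big_split /= subr_eq0; apply/eqP; congr (_ * _).
  apply: eq_bigr => j ji; rewrite !hornerE.
  have lij : lam i - lam j != 0.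
    by rewrite subr_eq0 (inj_eq lam_inj) eq_sym.
  by field; rewrite lij li.
pose rs := 0 :: [seq (lam i)^-1 | i : 'I_N].
have : (size rs < size d)%N.
  apply: max_poly_roots => //.
    by rewrite /= roots0; apply/allP=> x /mapP[i _ ->].
  rewrite /= map_inj_uniq ?enum_uniq ?andbT; last first.
    by move=> i j /invr_inj /lam_inj.
  by apply/negP=> /mapP[i _ /esym/eqP]; rewrite invr_eq0 (negbTE (lam_neq0 i)).
rewrite /= size_map size_enum_ord ltnNge; case/negP.
have sub (p q : {poly F}) : (size p <= N.+1)%N -> (size q <= N.+1)%N ->
    (size (p + q)%R <= N.+1)%N.
  by move=> p1 q1; rewrite (leq_trans (size_polyD _ _)) // geq_max p1.
have full (g : 'I_N -> {poly F}) : (forall i, size (g i) <= 2)%N ->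
    (size (\prod_(i < N) g i)%R <= N.+1)%N.
  by move=> g2; rewrite (leq_trans (size_prod _ _ g2)) // card_ord.
apply: (sub); last by rewrite size_polyN full.
apply: sub; first by rewrite full.
apply: (leq_trans (size_sum _ _ _)); apply/bigmax_leqP => i _.
rewrite -scalerAl (leq_trans (size_scale_leq _ _)) // mulrC.
apply: (leq_trans (size_polyMleq _ _)); rewrite size_polyX addn2 /= ltnS.
apply: (leq_trans (size_prod _ _ _)) => //.
by rewrite cardC1 card_ord prednK // (leq_ltn_trans _ (ltn_ord i)).
Qed.

(** Dividing the partial fraction identity by the product of the [1 - lam i X] leaves a sum of
    geometric series, whose coefficients are the [schurQ k]. *)
Lemma schurQ_gen n :
  eqmodX n ((\poly_(k < n) schurQ k) * \prod_(i < N) (1 - lam i *: 'X))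
           (\prod_(i < N) (1 + lam i *: 'X)).
Proof.
pose s := 1 + \sum_(i < N) (2 * lam i * schur_weight i) *: 'X * geomX n (lam i).
have Es : eqmodX n (\poly_(k < n) schurQ k) s.
  apply: coef_eqmodX => k kn; rewrite coef_poly kn /s coefD coef1 coef_sum.
  case: k kn => [|k] kn /=.
    by rewrite big1 ?addr0 // => i _; rewrite -scalerAl coefZ coefXM mulr0.
  rewrite add0r mulr_sumr; apply: eq_bigr => i _.
  by rewrite -scalerAl coefZ coefXM /= coef_poly (ltnW kn) exprS; ring.
apply: eqmodX_trans (eqmodXM Es (eqmodX_refl _ _)) _.
rewrite -schur_partial_fractions /s mulrDl mul1r mulr_suml.
apply: eqmodXD (eqmodX_refl _ _) _; apply: eqmodX_sum => i _.
rewrite [X in _ * X](bigD1 i) //=; set a := _ *: _; set g := geomX _ _.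
set P := \prod_(j < N | _) _.
have := eqmodXM (eqmodXM (eqmodX_refl n a) (geomXP n (lam i))) (eqmodX_refl n P).
by rewrite mulr1 -/g; congr (eqmodX _ _ _); ring.
Qed.

End SchurQFunctions.

(** * Generating series of the Harish-Chandra images of odd cyclic elements *)

Section CyclicPolynomials.
Variables (A : comNzRingType) (N : nat) (lam : 'I_N -> A).

(** The value, modulo raising elements on the right, of the diagonal entry at the positive index [a]
    of the twisted power of order [2m + 1]; see [Fpow_even_eval]. *)
Fixpoint cyclic_coord (m : nat) (a : 'I_N) : A :=
  if m is m'.+1 then
    lam a * (lam a - 1) * cyclic_coord m' a
    - 2 * lam a * \sum_(b < N | (a < b)%N) cyclic_coord m' b
  else lam a.

(** The factor [2] accounts for the negative indices, whose diagonal entries equal those at the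
    positive ones. *)
Definition cyclic_poly (m : nat) : A := 2 * \sum_(a < N) cyclic_coord m a.

End CyclicPolynomials.

Section CyclicGeneratingSeries.
Variables (F : fieldType) (N : nat) (lam : 'I_N -> F) (n : nat).

Let coord (a : 'I_N) : {poly F} := \poly_(m < n) cyclic_coord lam m a.

(** Cutting the sum at [k] allows a descending induction in which the factors of the product enter
    one at a time. *)
Let tail (k : nat) : {poly F} := 1 - 2 * 'X * \sum_(b < N | (k <= b)%N) coord b.

Lemma cyclic_coord_gen a :
  eqmodX n ((1 - (lam a * (lam a - 1)) *: 'X) * coord a) (lam a *: tail a.+1).
Proof.
apply: coef_eqmodX => m mn.
rewrite mulrBl mul1r -scalerAl coefB !coefZ coefB coef1.
rewrite -!mulrA mulr_natl coefMn !coefXM.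
rewrite coef_sum coef_poly mn; case: m mn => [|m] mn /=.
  by rewrite mul0rn !mulr0 !subr0 mulr1.
under [X in _ = _ * (_ - X *+ 2)]eq_bigr do rewrite coef_poly (ltnW mn).
rewrite coef_poly (ltnW mn) -mulr_natl; ring.
Qed.

(** With [l = lam k], passing from [tail k.+1] to [tail k] multiplies by
    [(1 - l (l + 1) X) / (1 - l (l - 1) X)]: the recursion subtracts a further [2 l X], and
    [l (l - 1) + 2 l = l (l + 1)]. *)
Lemma cyclic_gen :
  eqmodX n ((1 - 'X * \poly_(m < n) cyclic_poly lam m)
            * \prod_(a < N) (1 - (lam a * (lam a - 1)) *: 'X))
           (\prod_(a < N) (1 - (lam a * (lam a + 1)) *: 'X)).
Proof.
have tail_gen j : (j <= N)%N ->
    eqmodX n (tail (N - j) * \prod_(a < N | (N - j <= a)%N) (1 - (lam a * (lam a - 1)) *: 'X))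
             (\prod_(a < N | (N - j <= a)%N) (1 - (lam a * (lam a + 1)) *: 'X)).
  elim: j => [|j IHj] jN.
    have none : (fun a : 'I_N => N <= a)%N =1 pred0.
      by move=> a; rewrite leqNgt ltn_ord.
    rewrite subn0 /tail (eq_bigl _ _ none) big_pred0_eq mulr0 subr0 mul1r.
    rewrite (eq_bigl _ _ none) [X in eqmodX _ _ X](eq_bigl _ _ none) !big_pred0_eq.
    exact: eqmodX_refl.
  have kN : (N - j.+1 < N)%N by rewrite ltn_subrL (leq_trans _ jN).
  pose a := Ordinal kN.
  have Ea (b : 'I_N) : ((N - j.+1 <= b) && (b != a) = (N - j <= b))%N.
    by rewrite -(inj_eq val_inj) /= -(subnSK jN) [RHS]ltn_neqAle eq_sym andbC.
  rewrite (bigD1 a) //= [X in eqmodX _ _ X](bigD1 a) //=.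
  rewrite (eq_bigl _ _ Ea) [X in eqmodX _ _ (_ * X)](eq_bigl _ _ Ea).
  have := IHj (ltnW jN); set D := \prod_(_ < _ | _) _.
  set D' := \prod_(_ < _ | _) _ => IH.
  have -> : tail (N - j.+1) = tail (N - j) - 2 * 'X * coord a.
    rewrite /tail (bigD1 a) //= (eq_bigl _ _ Ea); ring.
  have := cyclic_coord_gen a; rewrite /= subnSK // => Ha.
  set l := lam a in Ha *; set t := tail _ in IH Ha *.
  have : eqmodX n ((1 - (l * (l - 1)) *: 'X) * (t * D)
                   - 2 * 'X * D * ((1 - (l * (l - 1)) *: 'X) * coord a))
                  ((1 - (l * (l - 1)) *: 'X) * D' - 2 * 'X * D * (l *: t)).
    by apply: eqmodXB; apply: eqmodXM => //; exact: eqmodX_refl.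
  set y := _ - 2 * 'X * D * (l *: t).
  have Hy : eqmodX n y ((1 - (l * (l + 1)) *: 'X) * D').
    have -> : y = (1 - (l * (l - 1)) *: 'X) * D' - (2 * l) *: 'X * (t * D).
      by rewrite /y -!mul_polyC; ring.
    have -> : (1 - (l * (l + 1)) *: 'X) * D'
        = (1 - (l * (l - 1)) *: 'X) * D' - (2 * l) *: 'X * D'.
      by rewrite -!mul_polyC; ring.
    by apply: eqmodXB (eqmodX_refl _ _) _; apply: eqmodXM IH; exact: eqmodX_refl.
  move=> H; apply: eqmodX_trans Hy; apply: eqmodX_trans H.
  rewrite [X in eqmodX _ X _](_ : _ =
    (1 - (l * (l - 1)) *: 'X) * (t * D)
    - 2 * 'X * D * ((1 - (l * (l - 1)) *: 'X) * coord a)); last by ring.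
  exact: eqmodX_refl.
have := tail_gen N (leqnn N); rewrite subnn /=; congr (eqmodX _ (_ * _) _).
rewrite /tail; congr (1 - _).
rewrite [2 * 'X]mulrC -mulrA; congr (_ * _); apply/polyP=> m.
rewrite mulr_natl coefMn coef_sum coef_poly /cyclic_poly.
under eq_bigr do rewrite /coord coef_poly.
by case: ifP => _; [rewrite mulr_natl | rewrite big1 ?mul0rn].
Qed.

End CyclicGeneratingSeries.

(** * Relations between Schur Q-functions and cyclic polynomials *)

Arguments schurQ : simpl never.

Section SchurQRelations.
Variables (F : fieldType) (N : nat) (lam : 'I_N -> F).
Hypothesis lam_inj : injective lam.
Hypothesis lam_neq0 : forall i, lam i != 0.

Notation a := (schurQ lam).
Notation g := (cyclic_poly lam).

Lemma prod_unit_at0 (u : 'I_N -> {poly F}) :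
  (forall i, (u i).[0] = 1) -> (\prod_i u i).[0] != 0.
Proof. by move=> u1; rewrite horner_prod (eq_bigr _ (fun i _ => u1 i)) big1_eq oner_eq0. Qed.

(** The sign change of the variable inverts the generating product, so [A(-X) A(X) = 1]; the
    relation is the coefficient of degree [2k]. *)
Lemma schurQ_even k : (0 < k)%N ->
  \sum_(i < k.*2.+1) (-1) ^+ i * a i * a (k.*2 - i) = 0.
Proof.
move=> k0; pose n := k.*2.+1.
pose A := \poly_(i < n) a i; pose A' := \poly_(i < n) ((-1) ^+ i * a i).
have EA' : A \Po ('X * (-1)%:P) = A'.
  rewrite /A /A' !poly_def linear_sum /=; apply: eq_bigr => i _.
  rewrite linearZ /= rmorphXn /= comp_polyX exprMn -polyC_exp mulrC mul_polyC.
  by rewrite scalerA mulrC.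
have linN (c : F) : (1 + c *: 'X) \Po ('X * (-1)%:P) = 1 - c *: 'X.
  rewrite rmorphD rmorph1 /= linearZ /= comp_polyX [_ * _%:P]mulrC mul_polyC.
  by rewrite scalerA mulrN1 scaleNr.
have H := schurQ_gen lam_inj lam_neq0 n; rewrite -/A in H.
have H' : eqmodX n (A' * \prod_i (1 + lam i *: 'X)) (\prod_i (1 - lam i *: 'X)).
  have := eqmodX_comp (-1)%:P H; rewrite rmorphM /= EA'.
  rewrite !rmorph_prod /=; congr (eqmodX _ (_ * _) _); apply: eq_bigr => i _.
    by rewrite -scaleNr linN scaleNr opprK.
  by rewrite linN.
have {H H'} : eqmodX n (A' * A) 1.
  have u0 : (\prod_(i < N) (1 - lam i *: 'X : {poly F})).[0] != 0.
    by apply: prod_unit_at0 => i; rewrite !hornerE /= ?mulr0 ?subr0.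
  apply: (eqmodX_cancel u0); rewrite mul1r -mulrA.
  by apply: eqmodX_trans H'; apply: eqmodXM H; exact: eqmodX_refl.
move/eqmodX_coef/(_ (ltnSn _)); rewrite coef1 coefM double_eq0 eqn0Ngt k0 /= => E.
apply: etrans E.
by apply: eq_bigr => i _; rewrite !coef_poly ltn_ord ltnS leq_subr.
Qed.

Let e n : {poly F} := geomX n 1.

Lemma geom1P n : eqmodX n ((1 - 'X) * e n) 1.
Proof. by have := geomXP n (1 : F); rewrite scale1r. Qed.

(* With [x = 1 / 'X], [e n] is [x / (x - 1)], so that composing with ['X * e]
   is the shift from [x] to [x - 1], and ['X * ('X * e)] is [1 / (x (x - 1))]. *)
Lemma schurQ_cyclic_gen n (A := \poly_(i < n) a i) (G := \poly_(m < n) g m) :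
  eqmodX n ((A \Po ('X * e n)) * (1 - 'X * ('X * e n) * (G \Po ('X * ('X * e n))))) A.
Proof.
set E := e n; set q1 := A \Po _; set G2 := G \Po _.
(* [p1] and [m1] are the factors of [q(x)]; [p2] and [m2] are those of [q(x - 1)] multiplied by
   [1 - 'X], the denominator that [clear] removes. *)
pose m1 i : {poly F} := 1 - lam i *: 'X; pose p1 i : {poly F} := 1 + lam i *: 'X.
pose m2 i : {poly F} := 1 - 'X - lam i *: 'X; pose p2 i : {poly F} := 1 - 'X + lam i *: 'X.
have HA : eqmodX n (A * \prod_i m1 i) (\prod_i p1 i) by exact: schurQ_gen.
have clear (u v w : 'I_N -> {poly F}) z :
    (forall i, eqmodX n ((1 - 'X) * u i) (v i)) ->
    eqmodX n (z * \prod_i u i) (\prod_i w i) ->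
    eqmodX n (z * \prod_i v i) (\prod_i ((1 - 'X) * w i)).
  move=> uv H; rewrite big_split /=.
  apply: (@eqmodX_trans _ _ (\prod_(i < N) (1 - 'X) * (z * \prod_i u i))).
    rewrite mulrCA -big_split /=; apply: eqmodXM (eqmodX_refl _ _) _.
    by apply: eqmodX_prod => i _; apply: eqmodX_sym.
  by apply: eqmodXM H; exact: eqmodX_refl.
have geomK q : eqmodX n (q * ((1 - 'X) * E)) q.
  by rewrite -[X in eqmodX _ _ X]mulr1; apply: eqmodXM (geom1P n); exact: eqmodX_refl.
have lin c (u : {poly F}) : (1 - c *: 'X) \Po u = 1 - c *: u.
  by rewrite rmorphB rmorph1 /= linearZ /= comp_polyX.
have H1 : eqmodX n (q1 * \prod_i m2 i) (\prod_i p2 i).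
  have := eqmodX_comp E HA; rewrite rmorphM !rmorph_prod /= -/q1 => /clear H.
  apply: eqmodX_trans (H m2 _) _ => [i|].
    rewrite lin /m2 -mul_polyC.
    apply: (@eqmodX_trans _ _ (1 - 'X - (lam i)%:P * 'X * ((1 - 'X) * E))).
      by apply: eq_eqmodX; ring.
    by rewrite -mul_polyC; apply: eqmodXB (eqmodX_refl _ _) (geomK _).
  apply: eqmodX_prod => i _.
  have -> : p1 i = 1 - (- lam i) *: 'X by rewrite scaleNr opprK.
  rewrite lin /p2 -!mul_polyC polyCN.
  rewrite (_ : _ * _ = 1 - 'X + (lam i)%:P * 'X * ((1 - 'X) * E)); last by ring.
  exact: eqmodXD (eqmodX_refl _ _) (geomK _).
(* Here the quadratic factors split: [1 - X - l (l - 1) X^2 = (1 - l X) (1 - X + l X)] and [1 - X -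
   l (l + 1) X^2 = (1 + l X) (1 - X - l X)]. *)
have H2 : eqmodX n ((1 - 'X * ('X * E) * G2) * \prod_i (m1 i * p2 i)) (\prod_i (p1 i * m2 i)).
  have quad c : eqmodX n ((1 - 'X) * (1 - c *: ('X * ('X * E)))) (1 - 'X - c *: ('X * 'X)).
    rewrite -!mul_polyC (_ : _ * _ = 1 - 'X - c%:P * ('X * 'X) * ((1 - 'X) * E)); last by ring.
    exact: eqmodXB (eqmodX_refl _ _) (geomK _).
  have := eqmodX_comp ('X * E) (cyclic_gen lam n).
  rewrite rmorphM !rmorph_prod rmorphB rmorph1 rmorphM /= comp_polyX -/G2 => /clear H.
  apply: eqmodX_trans (H (fun i => m1 i * p2 i) _) _ => [i|].
    rewrite lin; apply: eqmodX_trans (quad _) _.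
    rewrite (_ : _ - _ = m1 i * p2 i); first exact: eqmodX_refl.
    by rewrite /m1 /p2 -!mul_polyC polyCM polyCB; ring.
  apply: eqmodX_prod => i _; rewrite lin; apply: eqmodX_trans (quad _) _.
  rewrite (_ : _ - _ = p1 i * m2 i); first exact: eqmodX_refl.
  by rewrite /p1 /m2 -!mul_polyC polyCM polyCD; ring.
have u0 : (\prod_i m2 i * \prod_i (m1 i * p2 i)).[0] != 0.
  rewrite hornerM mulf_neq0 // prod_unit_at0 // => i; rewrite /m1 /m2 /p2 !hornerE /=;
  by rewrite ?mulr0 ?subr0 ?addr0 ?mulr1.
apply: (eqmodX_cancel u0).
set T2 := 1 - 'X * ('X * E) * G2 in H2 *.
rewrite [X in eqmodX _ X _](_ : _ =
  (q1 * \prod_i m2 i) * (T2 * \prod_i (m1 i * p2 i))); last by ring.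
apply: eqmodX_trans (eqmodXM H1 H2) _; rewrite !big_split /=.
rewrite [X in eqmodX _ _ X](_ : _ =
  (A * \prod_i m1 i) * (\prod_i m2 i * \prod_i p2 i)); last by ring.
rewrite [X in eqmodX _ X _](_ : _ = \prod_i p1 i * (\prod_i m2 i * \prod_i p2 i)); last by ring.
by apply: eqmodXM (eqmodX_refl _ _); apply: eqmodX_sym.
Qed.

Lemma coef_geomX_exp n r : (1 < n)%N -> (e n ^+ r)`_0 = 1 /\ (e n ^+ r)`_1 = r%:R.
Proof.
move=> n1; elim: r => [|r [IH0 IH1]]; first by rewrite expr0 !coef1.
rewrite exprS !coefM !big_ord_recl !big_ord0 /= IH0 IH1.
rewrite !coef_poly n1 (ltnW n1) !expr1n !mul1r !addr0 -[r.+1]addn1 natrD.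
by split.
Qed.

(** Coefficients of degree [2p + 2] in [schurQ_cyclic_gen] are compared. The even function
    [a p.*2.+2] occurs on both sides and cancels; the shift contributes [p.*2.+1%:R * a p.*2.+1],
    the term [m = p] contributes [g p], and the rest lies in [S]. *)
Lemma cyclic_poly_top (S : subringClosed F) p :
  (forall r, (r <= p.*2)%N -> a r \in S) ->
  (forall m, (m < p)%N -> g m \in S) ->
  g p - p.*2.+1%:R * a p.*2.+1 \in S.
Proof.
move=> aS gS; pose k := p.*2.+2; pose n := k.+1.
pose A := \poly_(i < n) a i; pose G := \poly_(m < n) g m; pose E := e n.
pose q1 := A \Po ('X * E).
have q1E j : q1`_j = \sum_(r < n) a r * (E ^+ r * 'X^r)`_j.
  rewrite /q1 /A poly_def linear_sum coef_sum; apply: eq_bigr => r _ /=.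
  by rewrite linearZ coefZ /= rmorphXn /= comp_polyX exprMn ['X^r * _]mulrC.
have ES r : E ^+ r \is a polyOver S.
  by apply: rpredX; apply: polyOver_poly => i _; rewrite expr1n rpred1.
have q1S j : (j <= p.*2)%N -> q1`_j \in S.
  move=> jp; rewrite q1E rpred_sum // => r _; rewrite coefMXn.
  case: ltnP => rj; first by rewrite mulr0 rpred0.
  by rewrite rpredM //; [apply/aS/(leq_trans rj) | exact/polyOverP].
have q1_0 : q1`_0 = 1.
  rewrite q1E big_ord_recl expr0 mulr1 coef1 mulr1 big1 ?addr0 // => r _.
  by rewrite coefMXn mulr0.
(* The two last powers of ['X * E] contribute through the coefficients of [E ^+ r] in degrees [0]
   and [1], which are [1] and [r]. *)
have q1_top : q1`_k - (a k + p.*2.+1%:R * a p.*2.+1) \in S.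
  have n1 : (1 < n)%N by [].
  rewrite q1E /n big_ord_recr big_ord_recr /= !coefMXn !ltnn subnn.
  rewrite ltnNge leqnSn /= subSnn.
  rewrite (coef_geomX_exp k n1).1 (coef_geomX_exp p.*2.+1 n1).2 mulr1.
  set t := \sum_(_ < _) _; set b := a k; set c := _%:R; set d := a _.
  have -> : t + d * c + b - (b + c * d) = t by ring.
  rewrite rpred_sum // => r _.
  rewrite coefMXn; case: ifP => _; first by rewrite mulr0 rpred0.
  by rewrite rpredM //; [apply: aS; rewrite -ltnS | exact/polyOverP].
have := eqmodX_coef (schurQ_cyclic_gen n) (ltnSn k).
rewrite -/A -/G -/E -/q1 coef_poly ltnSn mulrBr mulr1 coefB.
have -> : q1 * ('X * ('X * E) * (G \Po ('X * ('X * E))))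
    = \sum_(m < n) g m *: (q1 * E ^+ m.+1 * 'X^(m.*2.+2)).
  rewrite /G poly_def linear_sum mulr_sumr mulr_sumr /=; apply: eq_bigr => m _.
  rewrite linearZ /= rmorphXn /= comp_polyX -!scalerAr; congr (_ *: _).
  rewrite !exprMn -muln2 -[(m * 2).+2]/(2 + m * 2)%N exprD [(m * 2)%N]mulnC exprM.
  by rewrite exprS exprMn expr2; ring.
have lepn : (p < n)%N by rewrite /n /k ltnS -addnn; lia.
rewrite coef_sum (bigD1 (Ordinal lepn)) //= coefZ coefMXn ltnn subnn.
rewrite coef0M q1_0.
rewrite (coef_geomX_exp _ (isT : (1 < n)%N)).1 !mulr1.
set s := \sum_(_ < _ | _) _ => Hk.
(* Terms with [m > p] start beyond degree [k]; those with [m < p] only involve coefficients of [q1]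
   of degree at most [2p]. *)
have sS : s \in S.
  rewrite rpred_sum // => m /eqP mp; rewrite coefZ coefMXn.
  case: ltnP => mk; first by rewrite mulr0 rpred0.
  have {mk} mp' : (m < p)%N.
    rewrite ltn_neqAle; apply/andP; split; last by move: mk; rewrite /k; lia.
    by apply/eqP=> E'; apply: mp; apply: val_inj.
  rewrite rpredM ?gS // coefM rpred_sum // => j _.
  rewrite rpredM ?(polyOverP (ES _)) // q1S // (leq_trans (leq_ord j)) //.
  by rewrite /k !subSS leq_subr.
have -> : g p - p.*2.+1%:R * a p.*2.+1
    = (q1`_k - (a k + p.*2.+1%:R * a p.*2.+1)) - s.
  by rewrite -Hk; ring.
by rewrite rpredB.
Qed.

End SchurQRelations.

(** * Rational generation by the odd-indexed functions *)

Section RationalGeneration.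
Variables (F : fieldType) (phi : {rmorphism rat -> F}) (x : nat -> F).

(** Membership carries a witnessing polynomial over the rationals, which can later be evaluated at
    the elements [D] as well. *)
Definition odd_span (p : nat) : {pred F} :=
  fun y => `[< exists P : {mpoly rat[p]},
                 y = mmap phi (fun k : 'I_p => x k.*2.+1) P >].

Lemma odd_spanP p y :
  reflect (exists P : {mpoly rat[p]}, y = mmap phi (fun k : 'I_p => x k.*2.+1) P)
          (y \in odd_span p).
Proof. exact: asboolP. Qed.

Lemma odd_span_subring p : subring_closed (odd_span p).
Proof.
split=> [|y z /odd_spanP[P ->] /odd_spanP[Q ->]|y z /odd_spanP[P ->] /odd_spanP[Q ->]];
  apply/odd_spanP.
- by exists 1; rewrite rmorph1.
- by exists (P - Q); rewrite rmorphB.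
- by exists (P * Q); rewrite rmorphM.
Qed.

HB.instance Definition _ p :=
  GRing.isSubringClosed.Build F (odd_span p) (odd_span_subring p).

Lemma odd_span_gen p k : (k < p)%N -> x k.*2.+1 \in odd_span p.
Proof. by move=> kp; apply/odd_spanP; exists 'X_(Ordinal kp); rewrite mmapX mmap1U. Qed.

Lemma odd_span_mono p p' : (p <= p')%N -> {subset odd_span p <= odd_span p'}.
Proof.
move=> pp' y /odd_spanP[P ->].
elim/mpolyind: P => [|c m P _ _ IH]; first by rewrite raddf0 rpred0.
rewrite raddfD /= rpredD // mmapZ mmapX rpredM //.
  by apply/odd_spanP; exists c%:MP; rewrite mmapC.
by apply: rpred_prod => i _; apply/rpredX/odd_span_gen; exact: leq_trans pp'.
Qed.

Lemma odd_span_half p y : 2 * y \in odd_span p -> y \in odd_span p.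
Proof.
move=> /odd_spanP[P E]; apply/odd_spanP; exists (2%:R^-1 *: P).
have two : (2 : F) = phi 2%:R by rewrite rmorph_nat.
by rewrite mmapZ -E mulrA two -rmorphM mulVf ?rmorph1 ?mul1r // (pnatr_eq0 rat 2).
Qed.

End RationalGeneration.

Lemma uphalf_leq_double r k : (r <= k.*2)%N -> (uphalf r <= k)%N.
Proof. by move=> rk; rewrite -[k]uphalf_double uphalf_leq. Qed.

Section FactorialSchurQGeneration.
Variables (F : fieldType) (phi : {rmorphism rat -> F}).
Variables (N : nat) (lam : 'I_N -> F).
Hypothesis lam_inj : injective lam.
Hypothesis lam_neq0 : forall i, lam i != 0.

Notation q := (factorial_schurQ lam).
Notation S := (odd_span phi q).

(** [uphalf r] counts the odd numbers up to [r], so an odd [r] gives a generator. For an even [r]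
    the quadratic relation expresses the classical function through lower ones, and the
    unitriangular Stirling change carries this to the factorial function. *)
Lemma factorial_schurQ_odd_span r : q r \in S (uphalf r).
Proof.
elim/ltn_ind: r => r IHr.
have schurS i : (i < r)%N -> schurQ lam i \in S (uphalf i).
  move=> ir; rewrite schurQ_factorial rpred_sum // => j _.
  rewrite rpredM ?rpred_nat //; apply: (@odd_span_mono _ _ _ (uphalf j)).
    by rewrite uphalf_leq // leq_ord.
  by rewrite IHr // (leq_ltn_trans (leq_ord j)).
have [r_odd|r_even] := boolP (odd r).
  by rewrite -[X in q X](odd_double_half r) r_odd uphalf_half r_odd; exact: odd_span_gen.
have := even_halfK r_even; move: (r./2) => k Er; rewrite -Er in IHr schurS *.
rewrite uphalf_double; have [->|k0] := posnP k; first exact: rpred1.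
have lowS i : (i < k.*2)%N -> schurQ lam i \in S k.
  move=> ik; apply: odd_span_mono (schurS _ ik).
  exact/uphalf_leq_double/ltnW.
have : schurQ lam k.*2 \in S k.
  apply: odd_span_half; have := schurQ_even lam_inj lam_neq0 k0.
  case: k k0 {Er IHr r_even schurS} lowS => // k _ lowS.
  rewrite doubleS in lowS *.
  (* The first and the last term of the relation are both the even function sought, with sign [+];
     hence the division by [2]. *)
  rewrite big_ord_recl big_ord_recr /= /bump /= subn0 add1n subnn.
  rewrite -[in X in _ + (_ + X)]signr_odd /= negbK odd_double !expr0 !mul1r !mulr1.
  set s := \sum_(_ < _) _ => E.
  have -> : 2 * schurQ lam k.*2.+2 = - s by rewrite -[RHS]addr0 -E; ring.
  rewrite rpredN rpred_sum // => j _; apply: rpredM; last first.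
    by apply: lowS; rewrite subSS ltnS leq_subr.
  by apply: rpredM; [rewrite rpredX ?rpredN1 | apply: lowS; rewrite add1n ltnS].
rewrite schurQ_top => H.
rewrite -[q _](addrK (\sum_(j < k.*2) (stirling2 k.*2 j)%:R * q j)) rpredB //.
rewrite rpred_sum // => j _; rewrite rpredM ?rpred_nat //.
apply: odd_span_mono (IHr _ (ltn_ord j)).
exact/uphalf_leq_double/ltnW.
Qed.

Lemma schurQ_odd_span i : schurQ lam i \in S (uphalf i).
Proof.
rewrite schurQ_factorial rpred_sum // => j _.
rewrite rpredM ?rpred_nat //; apply: odd_span_mono (factorial_schurQ_odd_span j).
by rewrite uphalf_leq // leq_ord.
Qed.

(** The comparison of top coefficients is run in the ring of the first [p] odd factorial functions.
    Trading the classical function of index [2p + 1] for the factorial one costs only terms of lower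
    index. *)
Lemma cyclic_poly_odd_span p : cyclic_poly lam p - p.*2.+1%:R * q p.*2.+1 \in S p.
Proof.
elim/ltn_ind: p => p IHp.
have gS m : (m < p)%N -> cyclic_poly lam m \in S p.
  move=> mp; rewrite -[cyclic_poly _ _](subrK (m.*2.+1%:R * q m.*2.+1)) rpredD //.
    by apply: odd_span_mono (IHp m mp); exact: ltnW.
  by rewrite rpredM ?rpred_nat // odd_span_gen.
have aS r : (r <= p.*2)%N -> schurQ lam r \in S p.
  by move=> rp; apply: odd_span_mono (schurQ_odd_span r); exact: uphalf_leq_double.
have := cyclic_poly_top lam_inj lam_neq0 aS gS; rewrite schurQ_top mulrDr opprD addrA.
move=> H; rewrite -[_ - _](subrK (p.*2.+1%:R * 
   \sum_(r < p.*2.+1) (stirling2 p.*2.+1 r)%:R * q r)) rpredD //.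
rewrite rpredM ?rpred_nat // rpred_sum // => j _; rewrite rpredM ?rpred_nat //.
apply: odd_span_mono (factorial_schurQ_odd_span j); apply: uphalf_leq_double.
exact: leq_ord.
Qed.

End FactorialSchurQGeneration.

(** * Defining relations of U(q_N) *)

Section IndexParity.
Variable N : nat.
Implicit Types i j : 'I_(N + N).

Lemma par_pos (a : 'I_N) : par (pos a) = false.
Proof. by rewrite /par /= leqNgt ltn_ord. Qed.

Lemma par_neg i : par (neg i) = ~~ par i.
Proof.
by rewrite -(splitK i); case: (split i) => k /=;
  rewrite ?neg_lshift ?neg_rshift /par /= ?leq_addr leqNgt ltn_ord.
Qed.

Lemma neg_neq i : (neg i == i) = false.
Proof. by apply/negP => /eqP/(congr1 (@par N)); rewrite par_neg; case: (par i). Qed.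

Definition absi i : 'I_N := match split i with inl a => a | inr a => a end.

Lemma absi_pos a : absi (pos a) = a.
Proof. by rewrite /absi /pos -[lshift N a]/(unsplit (inl a)) unsplitK. Qed.

Lemma absi_neg i : absi (neg i) = absi i.
Proof.
rewrite -(splitK i); case: (split i) => k /=; rewrite ?neg_lshift ?neg_rshift /absi.
  by rewrite -[rshift N k]/(unsplit (inr k)) -[lshift N k]/(unsplit (inl k)) !unsplitK.
by rewrite -[rshift N k]/(unsplit (inr k)) -[lshift N k]/(unsplit (inl k)) !unsplitK.
Qed.

Variant index_spec : 'I_(N + N) -> 'I_N -> bool -> Type :=
| IndexPos a : index_spec (pos a) a false
| IndexNeg a : index_spec (neg (pos a)) a true.

Lemma indexP i : index_spec i (absi i) (par i).
Proof.
rewrite -(splitK i); case: (split i) => k /=.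
  by have := IndexPos k; rewrite -[lshift N k]/(pos k) absi_pos par_pos.
have := IndexNeg k; rewrite -neg_lshift -[lshift N k]/(pos k).
by rewrite absi_neg absi_pos par_neg par_pos.
Qed.

End IndexParity.

Section Relations.
Variables (K : fieldType) (N : nat).
Notation U := (Uq K N).
Notation F := (@Fgen K N).
Notation sg b := ((-1) ^+ (b : bool) : K).
Implicit Types (i j k l m : 'I_(N + N)) (u v : U).

Lemma UpiMr x y : @Upi K N (x * y) = Upi x * Upi y.
Proof. by rewrite -UpiM. Qed.

Lemma UpiZr c x : @Upi K N (c *: x) = c *: Upi x.
Proof. by rewrite -UpiZ. Qed.

Lemma UpiB x y : @Upi K N (x - y) = Upi x - Upi y.
Proof. by rewrite -scaleN1r UpiD UpiZr scaleN1r. Qed.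

Lemma Uiota_is_linear c X Y : Uiota (c *: X + Y) = c *: Uiota X + Uiota Y :> U.
Proof. by rewrite /Uiota -UpiZr -UpiD; apply: Upi_eq; exact: Uideal_linear. Qed.

HB.instance Definition _ :=
  GRing.isLinear.Build K (qN K N) U *:%R (@Uiota K N) Uiota_is_linear.

Lemma UiotaD X Y : Uiota (X + Y) = Uiota X + Uiota Y :> U.
Proof. exact: linearD. Qed.

Lemma UiotaZ c X : Uiota (c *: X) = c *: Uiota X :> U.
Proof. exact: linearZ. Qed.

Lemma UiotaB X Y : Uiota (X - Y) = Uiota X - Uiota Y :> U.
Proof. exact: linearB. Qed.

Lemma Uiota_bracket a b (X Y Z : qN K N) :
  homogeneous a (vsval X) -> homogeneous b (vsval Y) ->
  vsval Z = superbracket a b (vsval X) (vsval Y) ->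
  Uiota X * Uiota Y - sg (a && b) *: (Uiota Y * Uiota X) = Uiota Z.
Proof.
move=> aX bY XYZ; rewrite /Uiota -!UpiMr -UpiZr -UpiB; apply: Upi_eq.
have := Uideal_bracket aX bY XYZ; set p := fgen X * fgen Y; set q := fgen Y * fgen X.
case: (a && b); first by rewrite !expr1 mulN1r scaleN1r.
by rewrite !expr0 mul1r scale1r.
Qed.

Lemma vsval_F i j : vsval (vsproj (queer K N) (Fmx K i j)) = Fmx K i j.
Proof. by rewrite vsprojK // Fmx_queer. Qed.

Lemma Fmx_homogeneous i j : homogeneous (par i (+) par j) (Fmx K i j).
Proof.
move=> k l kl; rewrite !mxE.
case: andP => [[/eqP Ek /eqP El]|_]; first by rewrite Ek El eqxx in kl.
case: andP => [[/eqP Ek /eqP El]|_]; last by rewrite addr0.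
by rewrite Ek El !par_neg addNb addbN negbK eqxx in kl.
Qed.


Lemma Fmx_mul i j k l :
  Fmx K i j *m Fmx K k l
  = (j == k)%:R *: Fmx K i l + (neg j == k)%:R *: Fmx K (neg i) l.
Proof.
rewrite /Fmx mulmxDl !mulmxDr !mul_delta_mx_cond.
have E1 : (neg j == neg k) = (j == k) by apply: inj_eq; exact: can_inj (@negK N).
have E2 : (j == neg k) = (neg j == k) by apply/eqP/eqP => [->|<-]; rewrite negK.
rewrite E1 E2 negK; case: (j == k); case: (neg j == k);
  rewrite ?mulr1n ?mulr0n ?scale1r ?scale0r ?addr0 ?add0r //.
  by rewrite [X in _ + X]addrC addrACA [X in _ + X]addrC.
by rewrite addrC.
Qed.


Lemma F_neg i j : F (neg i) (neg j) = F i j.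
Proof. by rewrite /Fgen /Fmx !negK addrC. Qed.

(** A product of two matrices [Fmx] has two terms by [Fmx_mul], one for each sign of the inner
    index. Even and odd cases are treated together through [s]. *)
Lemma F_bracket i j k l (s := sg ((par i (+) par j) && (par k (+) par l))) :
  F i j * F k l - s *: (F k l * F i j)
  = (j == k)%:R *: F i l + (neg j == k)%:R *: F (neg i) l
    - s *: ((i == l)%:R *: F k j + (neg i == l)%:R *: F k (neg j)).
Proof.
have FnegC : F k (neg j) = F (neg k) j by rewrite -F_neg negK.
pose f x y := vsproj (queer K N) (Fmx K x y).
pose Z := (j == k)%:R *: f i l + (neg j == k)%:R *: f (neg i) l
    - s *: ((i == l)%:R *: f k j + (neg i == l)%:R *: f (neg k) j).
rewrite FnegC (@Uiota_bracket _ _ (f i j) (f k l) Z) /Z ?vsval_F.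
- by rewrite UiotaB !(UiotaD, UiotaZ).
- exact: Fmx_homogeneous.
- exact: Fmx_homogeneous.
have E1 : (l == i) = (i == l) by exact: eq_sym.
have E2 : (neg l == i) = (neg i == l) by apply/eqP/eqP => [<-|<-]; rewrite negK.
have vD (X Y : qN K N) : vsval (X + Y) = vsval X + vsval Y by [].
have vB (X Y : qN K N) : vsval (X - Y) = vsval X - vsval Y by [].
have vZ c (X : qN K N) : vsval (c *: X) = c *: vsval X by [].
by rewrite vB vD !vZ vD !vZ !vsval_F /superbracket !Fmx_mul E1 E2.
Qed.

Lemma Uiota_ind (P : U -> Prop) :
  P 0 -> (forall u v, P u -> P v -> P (u + v)) ->
  (forall c i j, P (c *: F i j)) -> forall X, P (Uiota X).
Proof.
move=> P0 PD PF X.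
have Psum (I : Type) (s : seq I) (f : I -> 'M[K]_(N + N)) :
    (forall x, P (Uiota (vsproj (queer K N) (f x)))) ->
    P (Uiota (vsproj (queer K N) (\sum_(x <- s) f x))).
  move=> Pf; elim: s => [|x s IHs]; first by rewrite big_nil !linear0; exact: P0.
  by rewrite big_cons (linearD (vsproj _)) UiotaD; exact: PD (Pf x) IHs.
rewrite -(vsvalK X); have /memv_sumP[v vP ->] := subvsP X; apply: (Psum) => i.
have /memv_sumP[w wP ->] := vP i isT; apply: Psum => j.
have /vlineP[c ->] := wP j isT.
have -> : vsproj (queer K N) (c *: Fmx K i j) = c *: vsproj (queer K N) (Fmx K i j).
  exact: linearZ.
by rewrite UiotaZ; exact: PF.
Qed.

End Relations.

(** * Twisted powers of the generating matrix *)

Section CommutingEvaluation.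
Variables (n : nat) (R : comNzRingType) (S : nzRingType) (f : {rmorphism R -> S}) (h : 'I_n -> S).
Hypothesis h_comm : forall i j, GRing.comm (h i) (h j).
Hypothesis f_comm : forall c x, GRing.comm (f c) x.

Lemma mmap1M_comm m1 m2 : mmap1 h (m1 + m2) = mmap1 h m1 * mmap1 h m2.
Proof.
rewrite /mmap1 (eq_bigr (fun i => h i ^+ m1 i * h i ^+ m2 i)); last first.
  by move=> i _; rewrite mnmDE exprD.
have powC i j a b : GRing.comm (h i ^+ a) (h j ^+ b).
  by apply/commrX/commr_sym/commrX.
elim: (index_enum _) => [|i s IHs]; first by rewrite !big_nil mulr1.
rewrite !big_cons IHs -!mulrA; congr (_ * _); rewrite !mulrA; congr (_ * _).
by apply: commr_prod => j _; exact: powC.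
Qed.

(** Meant for the elements [F_ii], which commute although the enveloping algebra does not. *)
Lemma mmapM_comm : {morph mmap f h : p q / p * q}.
Proof.
move=> p q; elim/mpolyind: p => [|c m p _ _ IHp]; first by rewrite mul0r !raddf0 mul0r.
rewrite mulrDl !raddfD /= mulrDl IHp -scalerAl !mmapZ -mulrA mmapX; congr (_ * _ + _).
elim/mpolyind: q {IHp} => [|d m' q _ _ IHq]; first by rewrite mulr0 !raddf0 mulr0.
rewrite mulrDr !raddfD /= mulrDr IHq -scalerAr -mpolyXD !mmapZ !mmapX mmap1M_comm.
by rewrite !mulrA (f_comm d).
Qed.

End CommutingEvaluation.

Section MatrixPowers.
Variables (K : fieldType) (N : nat) (A : algType K).
Variable F : 'I_(N + N) -> 'I_(N + N) -> A.
Notation sg b := ((-1) ^+ (b : bool) : K).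
Hypothesis F_negneg : forall i j, F (neg i) (neg j) = F i j.
Hypothesis F_comm : forall i j k l,
  let s := sg ((par i (+) par j) && (par k (+) par l)) in
  F i j * F k l - s *: (F k l * F i j)
  = (j == k)%:R *: F i l + (neg j == k)%:R *: F (neg i) l
    - s *: ((i == l)%:R *: F k j + (neg i == l)%:R *: F k (neg j)).
Implicit Types (i j k l m : 'I_(N + N)).

(* [Fpow r] is the matrix power F^(r+1) twisted by the parities of the inner indices. *)
Fixpoint Fpow (r : nat) (i j : 'I_(N + N)) : A :=
  if r is r'.+1 then \sum_m sg (par m) *: (F i m * Fpow r' m j) else F i j.

Lemma sgM b c : sg b * sg c = sg (b (+) c).
Proof. by rewrite signr_addb. Qed.

Lemma sum_delta (i : 'I_(N + N)) (f : 'I_(N + N) -> A) :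
  \sum_m (i == m)%:R *: f m = f i.
Proof.
rewrite (bigD1 i) //= eqxx scale1r big1 ?addr0 // => m mi.
by rewrite eq_sym (negbTE mi) scale0r.
Qed.

(** The parity twist makes the powers transform under the superbracket as [F] itself does. The super
    Leibniz rule splits the bracket over the two factors, and the terms touching the inner index
    cancel. *)
Lemma Fpow_bracket r i j k l (s := sg ((par i (+) par j) && (par k (+) par l))) :
  F i j * Fpow r k l - s *: (Fpow r k l * F i j)
  = (j == k)%:R *: Fpow r i l + (neg j == k)%:R *: Fpow r (neg i) l
    - s *: ((i == l)%:R *: Fpow r k j + (neg i == l)%:R *: Fpow r k (neg j)).
Proof.
elim: r i j k l @s => [|r IHr] i j k l s; first exact: F_comm.
pose p (x y : 'I_(N + N)) : bool := par x (+) par y.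
pose s1 m := sg (p i j && p k m); pose s2 m := sg (p i j && p m l).
have s12 m : s1 m * s2 m = s.
  rewrite sgM /s /p; congr (sg _).
  by case: (par i); case: (par j); case: (par k); case: (par l); case: (par m).
pose B1 m := F i j * F k m - s1 m *: (F k m * F i j).
pose B2 m := F i j * Fpow r m l - s2 m *: (Fpow r m l * F i j).
have step m : F i j * (F k m * Fpow r m l) - s *: (F k m * Fpow r m l * F i j)
    = B1 m * Fpow r m l + s1 m *: (F k m * B2 m).
  rewrite /B1 /B2 mulrBl mulrBr scalerBr -scalerAl -scalerAr scalerA s12 !mulrA.
  by rewrite subrKA.
transitivity (\sum_m sg (par m) *: (B1 m * Fpow r m l)
              + \sum_m (sg (par m) * s1 m) *: (F k m * B2 m)).
  rewrite /= mulr_sumr mulr_suml scaler_sumr -sumrB -big_split /=.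
  apply: eq_bigr => m _.
  rewrite -scalerAr -scalerAl [s *: _]scalerA [s * _]mulrC -[(_ * s) *: _]scalerA.
  by rewrite -scalerBr step scalerDr scalerA.
have sum1 : \sum_m sg (par m) *: (B1 m * Fpow r m l)
    = (j == k)%:R *: Fpow r.+1 i l + (neg j == k)%:R *: Fpow r.+1 (neg i) l
      - ((sg (par i) * s1 i) *: (F k j * Fpow r i l)
         + (sg (par (neg i)) * s1 (neg i)) *: (F k (neg j) * Fpow r (neg i) l)).
  have -> : \sum_m sg (par m) *: (B1 m * Fpow r m l)
     = \sum_m ((j == k)%:R *: (sg (par m) *: (F i m * Fpow r m l))
        + (neg j == k)%:R *: (sg (par m) *: (F (neg i) m * Fpow r m l))
        - ((i == m)%:R *: ((sg (par m) * s1 m) *: (F k j * Fpow r m l))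
          + (neg i == m)%:R *: ((sg (par m) * s1 m) *: (F k (neg j) * Fpow r m l)))).
    apply: eq_bigr => m _; rewrite /B1 F_comm -/(p i j) -/(p k m) -/(s1 m).
    rewrite mulrBl -scalerAl !mulrDl -!scalerAl !(scalerBr, scalerDr) !scalerA.
    by congr (_ *: _ + _ *: _ - (_ *: _ + _ *: _)); ring.
  by rewrite sumrB !big_split /= !sum_delta -!scaler_sumr.
have sum2 : \sum_m (sg (par m) * s1 m) *: (F k m * B2 m)
    = (sg (par j) * s1 j) *: (F k j * Fpow r i l)
      + (sg (par (neg j)) * s1 (neg j)) *: (F k (neg j) * Fpow r (neg i) l)
      - s *: ((i == l)%:R *: Fpow r.+1 k j + (neg i == l)%:R *: Fpow r.+1 k (neg j)).
  have -> : \sum_m (sg (par m) * s1 m) *: (F k m * B2 m)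
     = \sum_m ((j == m)%:R *: ((sg (par m) * s1 m) *: (F k m * Fpow r i l))
        + (neg j == m)%:R *: ((sg (par m) * s1 m) *: (F k m * Fpow r (neg i) l))
        - s *: ((i == l)%:R *: (sg (par m) *: (F k m * Fpow r m j))
             + (neg i == l)%:R *: (sg (par m) *: (F k m * Fpow r m (neg j))))).
    apply: eq_bigr => m _; rewrite /B2 IHr -/(p i j) -/(p m l) -/(s2 m).
    rewrite mulrBr -scalerAr !mulrDr -!scalerAr !(scalerBr, scalerDr) !scalerA.
    by rewrite -(s12 m); congr (_ *: _ + _ *: _ - (_ *: _ + _ *: _)); ring.
  by rewrite sumrB !big_split /= !sum_delta -!scaler_sumr big_split /= -!scaler_sumr.
rewrite sum1 sum2.
(* The terms touching the inner index occur in [sum1] and [sum2] with opposite signs in front of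
   equal parity factors. *)
have signs : sg (par i) * s1 i = sg (par j) * s1 j.
  rewrite !sgM /p; congr (sg _).
  by case: (par i); case: (par j); case: (par k).
have nsigns : sg (par (neg i)) * s1 (neg i) = sg (par (neg j)) * s1 (neg j).
  rewrite !sgM /p !par_neg; congr (sg _).
  by case: (par i); case: (par j); case: (par k).
by rewrite signs nsigns addrA subrK.
Qed.

(** Changing the sign of all [r] inner indices reverses [r] parity factors. *)
Lemma Fpow_neg r i j : Fpow r (neg i) (neg j) = sg (odd r) *: Fpow r i j.
Proof.
elim: r i j => [|r IHr] i j; first by rewrite /= F_negneg scale1r.
rewrite /= (reindex_inj (can_inj (@negK N))) /= scaler_sumr; apply: eq_bigr => m _.
rewrite F_negneg IHr -scalerAr !scalerA par_neg !sgM; congr (sg _ *: _).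
by case: (par m); case: (odd r).
Qed.

Lemma sum_index (f : 'I_(N + N) -> A) :
  \sum_m f m = \sum_(b < N) (f (pos b) + f (neg (pos b))).
Proof.
rewrite big_split_ord /= -big_split /=; apply: eq_bigr => b _.
by rewrite /pos neg_lshift.
Qed.

(** For [k = l] the sign [s] is trivial, and the Kronecker terms cancel after summation over [k].
    This is the centrality of the cyclic elements. *)
Lemma Fpow_trace_comm r i j (C := \sum_k Fpow r k k) : F i j * C = C * F i j.
Proof.
apply/eqP; rewrite -subr_eq0 /C mulr_sumr mulr_suml -sumrB; apply/eqP.
pose d (x y : 'I_(N + N)) : K := (x == y)%:R.
transitivity (\sum_k ((d j k *: Fpow r i k + d (neg j) k *: Fpow r (neg i) k)
   - (d i k *: Fpow r k j + d (neg i) k *: Fpow r k (neg j)))).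
  apply: eq_bigr => k _; have := Fpow_bracket r i j k k.
  by rewrite /= addbb andbF expr0 !scale1r.
by rewrite sumrB !big_split /= !sum_delta subrr.
Qed.

Let h a := F (pos a) (pos a).
Let f a := F (pos a) (neg (pos a)).

Lemma pos_eq (a b : 'I_N) : (pos a == pos b) = (a == b).
Proof. exact: inj_eq (@lshift_inj N N) _ _. Qed.

Lemma neg_pos_eq (a b : 'I_N) : (neg (pos a) == pos b) = false.
Proof. by apply/negP => /eqP/(congr1 (@par N)); rewrite par_neg !par_pos. Qed.

Lemma cartan_comm a b : h a * h b = h b * h a.
Proof.
apply/eqP; rewrite -subr_eq0; have := F_comm (pos a) (pos a) (pos b) (pos b).
rewrite /= !par_pos /= expr0 !scale1r => ->.
rewrite !neg_pos_eq pos_eq !scale0r !addr0; have [->|_] := eqVneq a b.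
  by rewrite subrr.
by rewrite !scale0r subr0.
Qed.

Lemma cartan_weight0 a b c :
  h a * F (pos b) (pos c)
  = F (pos b) (pos c) * h a + ((a == b)%:R - (a == c)%:R) *: F (pos b) (pos c).
Proof.
apply/eqP; rewrite [X in _ == X]addrC -subr_eq; apply/eqP.
have := F_comm (pos a) (pos a) (pos b) (pos c).
rewrite /= !par_pos /= expr0 !scale1r -/(h a) => ->.
rewrite !neg_pos_eq !pos_eq !scale0r !addr0 scalerBl.
by case: (eqVneq a b) => [<-|_]; case: (eqVneq a c) => [<-|_]; rewrite ?scale0r.
Qed.

Lemma cartan_weight1 a b c :
  h a * F (pos b) (neg (pos c))
  = F (pos b) (neg (pos c)) * h a + ((a == b)%:R - (a == c)%:R) *: F (pos b) (neg (pos c)).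
Proof.
apply/eqP; rewrite [X in _ == X]addrC -subr_eq; apply/eqP.
have := F_comm (pos a) (pos a) (pos b) (neg (pos c)).
rewrite /= par_neg !par_pos /= expr0 !scale1r -/(h a) => ->.
have -> : (pos a == neg (pos c)) = false by rewrite eq_sym neg_pos_eq.
rewrite (inj_eq (can_inj (@negK N))) neg_pos_eq !pos_eq !scale0r addr0 add0r scalerBl.
by case: (eqVneq a b) => [<-|_]; case: (eqVneq a c) => [<-|_]; rewrite ?scale0r.
Qed.

Lemma cartan_odd_comm a : f a * h a = h a * f a.
Proof.
apply/eqP; rewrite eq_sym -subr_eq0; apply/eqP.
have := F_comm (pos a) (pos a) (pos a) (neg (pos a)).
rewrite /= !par_neg !par_pos /= expr0 !scale1r -/(h a) -/(f a) => ->.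
rewrite !eqxx neg_pos_eq [_ == neg _]eq_sym neg_pos_eq !scale0r addr0 add0r.
by rewrite !scale1r subrr.
Qed.

Hypothesis two_neq0 : (2 : K) != 0.

Lemma cartan_odd_sqr a : f a * f a = h a.
Proof.
have := F_comm (pos a) (neg (pos a)) (pos a) (neg (pos a)).
rewrite /= !par_neg !par_pos /= expr1 -/(f a) !negK.
rewrite neg_pos_eq [pos a == neg _]eq_sym neg_pos_eq !eqxx !scale0r !add0r.
rewrite !scale1r !scaleN1r !opprK F_negneg -!mulr2n -/(h a) -!scaler_nat.
by move/(scalerI two_neq0).
Qed.

(** [J] stands for the left ideal [U n_+]; comparing absolute values of indices covers even and odd
    raising elements together. *)
Variable J : A -> Prop.
Hypotheses (J0 : J 0) (JD : forall u v, J u -> J v -> J (u + v)).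
Hypotheses (JM : forall u v, J v -> J (u * v)).
Hypothesis JF : forall i j, (absi i < absi j)%N -> J (F i j).

Let JZ c u : J u -> J (c *: u).
Proof. by move=> Ju; rewrite -[u]mul1r scalerAl; exact: JM. Qed.

Let Jsum (I : Type) (s : seq I) (P : pred I) (g : I -> A) :
  (forall x, P x -> J (g x)) -> J (\sum_(x <- s | P x) g x).
Proof. by move=> Jg; apply: big_ind. Qed.

(** If [|m| < |j|] the right factor is in [J] by induction. Otherwise [|i| < |m|], and moving
    [F i m] to the right leaves the same entry of a lower power. *)
Lemma Fpow_raise r i j : (absi i < absi j)%N -> J (Fpow r i j).
Proof.
elim: r i j => [|r IHr] i j ij /=; first exact: JF.
apply: Jsum => m _; apply: JZ; case: (ltnP (absi m) (absi j)) => mj.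
  by apply/JM/IHr.
have im := leq_trans ij mj.
rewrite -[F i m * _](subrK (sg ((par i (+) par m) && (par m (+) par j)) *: (Fpow r m j * F i m))).
apply: JD; last by apply/JZ/JM/JF.
rewrite Fpow_bracket eqxx scale1r neg_neq scale0r addr0.
have -> : (i == j) = false by apply/eqP => E; rewrite E ltnn in ij.
have -> : (neg i == j) = false by apply/eqP => E; rewrite -E absi_neg ltnn in ij.
by rewrite !scale0r addr0 scaler0 subr0; exact: IHr.
Qed.

Let cg u v := J (u - v).

Let cg_refl u : cg u u. Proof. by rewrite /cg subrr. Qed.

Let cg_trans v u w : cg u v -> cg v w -> cg u w.
Proof. by move=> uv vw; rewrite /cg -(subrKA v); exact: JD. Qed.

Let cgD u u' v v' : cg u u' -> cg v v' -> cg (u + v) (u' + v').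
Proof. by move=> uu' vv'; rewrite /cg opprD addrACA; exact: JD. Qed.

Let cgM w u v : cg u v -> cg (w * u) (w * v).
Proof. by move=> uv; rewrite /cg -mulrBr; exact: JM. Qed.

Let cgZ c u v : cg u v -> cg (c *: u) (c *: v).
Proof. by move=> uv; rewrite /cg -scalerBr; exact: JZ. Qed.

Let cgsum (I : Type) (s : seq I) (P : pred I) (g g' : I -> A) :
  (forall x, P x -> cg (g x) (g' x)) ->
  cg (\sum_(x <- s | P x) g x) (\sum_(x <- s | P x) g' x).
Proof. by move=> gg'; rewrite /cg -sumrB; exact: Jsum. Qed.

Lemma Fpow_diag_step r i j m (s := sg ((par i (+) par m) && (par m (+) par j))) :
  (absi i < absi m)%N ->
  cg (F i m * Fpow r m j)
     (Fpow r i j - s *: ((i == j)%:R *: Fpow r m m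
                         + (neg i == j)%:R *: Fpow r m (neg m))).
Proof.
move=> im; have := Fpow_bracket r i m m j.
rewrite eqxx neg_neq scale1r scale0r addr0 -/s => <-.
by rewrite /cg subKr; apply/JZ/JM/JF.
Qed.

(** The inner index is split by absolute value: [a] itself gives the Cartan terms, smaller values
    vanish by [Fpow_raise], larger ones are collected in [g]. *)
Lemma Fpow_diag r a j (g : 'I_N -> A)
    (t := fun m => sg (par m) *: (F (pos a) m * Fpow r m j)) :
  absi j = a ->
  (forall b : 'I_N, (a < b)%N -> cg (t (pos b) + t (neg (pos b))) (- g b)) ->
  cg (Fpow r.+1 (pos a) j)
     (h a * Fpow r (pos a) j - f a * Fpow r (neg (pos a)) j
      - \sum_(b < N | (a < b)%N) g b).
Proof.
move=> ja tg; rewrite /= sum_index (bigD1 a) //=.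
apply: cgD; first by rewrite par_neg par_pos expr0 expr1 scale1r scaleN1r.
rewrite (bigID (fun b : 'I_N => (a < b)%N)) /= -[X in cg _ X]addr0; apply: cgD.
  rewrite -sumrN [X in cg X _](eq_bigl (fun b : 'I_N => (a < b)%N)); last first.
    by move=> b; apply: andb_idl => ab; rewrite -(inj_eq val_inj) /= neq_ltn ab orbT.
  exact: cgsum.
rewrite /cg subr0; apply: Jsum => b /andP[ba]; rewrite -leqNgt leq_eqVlt.
have -> /= : (b == a :> nat) = false by apply: negbTE.
by move=> lt_ba; apply: JD; apply/JZ/JM/Fpow_raise; rewrite ?absi_neg absi_pos ja.
Qed.

Lemma Fpow_neg_pos r a : Fpow r (neg (pos a)) (pos a) = sg (odd r) *: Fpow r (pos a) (neg (pos a)).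
Proof. by rewrite -Fpow_neg negK. Qed.

(** The inner indices [b] and [-b] enter with opposite signs, so the copies of the entry at [a]
    cancel, while those at [b] add up or cancel according to the parity of [r]. *)
Lemma Fpow_diagX r a :
  cg (Fpow r.+1 (pos a) (pos a))
     (h a * Fpow r (pos a) (pos a) - sg (odd r) *: (f a * Fpow r (pos a) (neg (pos a)))
      - \sum_(b < N | (a < b)%N) (1 + sg (odd r)) *: Fpow r (pos b) (pos b)).
Proof.
have := @Fpow_diag r a (pos a) (fun b => (1 + sg (odd r)) *: Fpow r (pos b) (pos b)).
rewrite Fpow_neg_pos -scalerAr; apply; first exact: absi_pos.
move=> b ab; have ab' : (absi (pos a) < absi (pos b))%N by rewrite !absi_pos.
have ab'' : (absi (pos a) < absi (neg (pos b)))%N by rewrite absi_neg !absi_pos.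
apply: cg_trans (cgD (cgZ _ (Fpow_diag_step r _ ab')) (cgZ _ (Fpow_diag_step r _ ab''))) _.
rewrite !par_neg !par_pos /= !expr1 !expr0 neg_pos_eq eqxx.
rewrite -[false%:R]/(0 : K) -[true%:R]/(1 : K) !scale0r !addr0 !scale1r.
rewrite !scaleN1r opprK opprD addrACA subrr add0r -opprD Fpow_neg scalerDl scale1r.
exact: cg_refl.
Qed.

Lemma Fpow_diagY r a : ~~ odd r ->
  cg (Fpow r.+1 (pos a) (neg (pos a)))
     (h a * Fpow r (pos a) (neg (pos a)) - f a * Fpow r (pos a) (pos a)).
Proof.
move=> r_even; have := @Fpow_diag r a (neg (pos a)) (fun=> 0).
rewrite big1_eq subr0 Fpow_neg (negbTE r_even) scale1r; apply.
  by rewrite absi_neg absi_pos.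
move=> b ab; have ab' : (absi (pos a) < absi (pos b))%N by rewrite !absi_pos.
have ab'' : (absi (pos a) < absi (neg (pos b)))%N by rewrite absi_neg !absi_pos.
apply: cg_trans (cgD (cgZ _ (Fpow_diag_step r _ ab')) (cgZ _ (Fpow_diag_step r _ ab''))) _.
rewrite !par_neg !par_pos /= !expr1 !expr0 eqxx [pos a == _]eq_sym neg_pos_eq.
rewrite -[false%:R]/(0 : K) -[true%:R]/(1 : K) !scale0r !add0r !scale1r negK.
rewrite Fpow_neg_pos (negbTE r_even) scale1r.
by rewrite scaleN1r subrr oppr0; exact: cg_refl.
Qed.

(** Since [f a] commutes with [h a] and squares to it, the odd entries cancel after two steps and
    [h a ^+ 2] becomes [h a * (h a - 1)]. *)
Lemma Fpow_diag2 r a : ~~ odd r ->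
  cg (Fpow r.+2 (pos a) (pos a))
     (h a * (h a - 1) * Fpow r (pos a) (pos a)
      - 2%:R *: (h a * \sum_(b < N | (a < b)%N) Fpow r (pos b) (pos b))).
Proof.
move=> r_even; apply: cg_trans (Fpow_diagX _ _) _.
rewrite [odd r.+1]/= r_even expr1 scaleN1r opprK subrr.
rewrite big1 ?subr0 => [|b _]; last by rewrite scale0r.
apply: cg_trans (cgD (cgM _ (Fpow_diagX r a)) (cgM _ (Fpow_diagY a r_even))) _.
rewrite (negbTE r_even) expr0 scale1r -scaler_sumr.
set X := Fpow _ _ _; set Y := Fpow _ _ _; set S := \sum_(_ < _ | _) _.
have -> : h a * (h a * X - f a * Y - (1 + 1) *: S) + f a * (h a * Y - f a * X)
    = h a * (h a - 1) * X - 2%:R *: (h a * S).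
  rewrite !mulrBr !mulrA cartan_odd_comm cartan_odd_sqr mulr1 mulrBl -scalerAr.
  by rewrite [_ - _ - _ *: _]addrAC subrKA addrAC.
exact: cg_refl.
Qed.

Lemma Fpow_even_eval n a (ev := mmap (in_alg A) h) :
  cg (Fpow n.*2 (pos a) (pos a)) (ev (cyclic_coord (fun b : 'I_N => 'X_b) n a)).
Proof.
have evM : {morph ev : p q / p * q}.
  apply: mmapM_comm => [|c x]; first exact: cartan_comm.
  by rewrite /GRing.comm -scalerAl -scalerAr mul1r mulr1.
have evX b : ev 'X_b = h b by rewrite /ev mmapX mmap1U.
have ev1 : ev 1 = 1 by rewrite /ev -mpolyC1 mmapC /= scale1r.
have evB p q : ev (p - q) = ev p - ev q by rewrite /ev raddfB.
have ev2 p : ev (2 * p) = 2%:R *: ev p by rewrite /ev mulr_natl raddfMn scaler_nat.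
elim: n a => [|n IHn] a; first by rewrite /= evX; exact: cg_refl.
rewrite doubleS; apply: cg_trans (Fpow_diag2 _ _) _; first by rewrite odd_double.
rewrite /= evB -[2 * _ * _]mulrA ev2 !evM evB evX ev1 -!scaleNr.
apply: cgD; first exact: cgM.
apply/cgZ/cgM; rewrite /ev raddf_sum; exact: cgsum.
Qed.

Lemma trace_even_eval n (ev := mmap (in_alg A) h) :
  cg (\sum_i Fpow n.*2 i i) (ev (cyclic_poly (fun b : 'I_N => 'X_b) n)).
Proof.
rewrite sum_index /cyclic_poly mulr_natl /ev raddfMn raddf_sum -sumrMnl /=.
apply: cgsum => b _; rewrite Fpow_neg odd_double scale1r -mulr2n -!scaler_nat.
exact/cgZ/Fpow_even_eval.
Qed.

End MatrixPowers.

(** * Cyclic elements as traces of twisted powers *)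

Section CyclicWords.
Variables (K : fieldType) (N : nat) (A : algType K).
Variable F : 'I_(N + N) -> 'I_(N + N) -> A.
Notation T := 'I_(N + N).

Lemma big_tuple_cons (B : nmodType) r (E : r.+1.-tuple T -> B) :
  \sum_t E t = \sum_m \sum_(t : r.-tuple T) E [tuple of m :: t].
Proof.
rewrite pair_bigA /=; apply: (reindex (fun p : T * r.-tuple T => [tuple of p.1 :: p.2])).
exists (fun t => (thead t, [tuple of behead t])) => [[m t] _|t _] /=.
  by congr (_, _); apply: val_inj.
by rewrite [RHS]tuple_eta; apply: val_inj.
Qed.

(** At [k = r] the default [j] of [nth j t k] supplies the closing index of the word. *)
Lemma Fpow_words r i j :
  Fpow F r i j = \sum_(t : r.-tuple T) (-1) ^+ (\sum_(x <- t) par x)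
    *: \prod_(k < r.+1) F (nth j (i :: t) k) (nth j t k).
Proof.
elim: r i j => [|r IHr] i j.
  rewrite (big_pred1 ([tuple] : 0.-tuple T)) => [|t].
    by rewrite big_nil scale1r big_ord1.
  by apply/esym/eqP/val_inj; case: t => -[].
rewrite big_tuple_cons; apply: eq_bigr => m _.
rewrite -/(Fpow F r m j) IHr mulr_sumr scaler_sumr; apply: eq_bigr => t _.
by rewrite -scalerAr scalerA big_cons -exprD [in RHS]big_ord_recl.
Qed.

Lemma cyclic_words r :
  \sum_(i : {ffun 'I_r.+1 -> T})
    (-1) ^+ (\sum_(k < r.+1 | k != 0%N :> nat) par (i k))
    * \prod_(k < r.+1) F (i k) (i (ordS k)) = \sum_i Fpow F r i i.
Proof.
rewrite (reindex (fun t : r.+1.-tuple T => [ffun k => tnth t k])) /=; last first.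
  exists (fun f : {ffun _} => [tuple f k | k < r.+1]) => [t _|f _].
    by apply: eq_from_tnth => k; rewrite tnth_mktuple ffunE.
  by apply/ffunP => k; rewrite ffunE tnth_mktuple.
rewrite big_tuple_cons; apply: eq_bigr => i _; rewrite Fpow_words.
apply: eq_bigr => t _.
rewrite (_ : (\sum_(k < r.+1 | _) _)%N = \sum_(x <- t) par x)%N; last first.
  rewrite big_mkcond big_ord_recl /= add0n big_tuple.
  by apply: eq_bigr => k _; rewrite ffunE tnthS.
rewrite -signr_odd -[in RHS]signr_odd.
rewrite [X in _ * X = _](_ : _ = \prod_(k < r.+1) F (nth i (i :: t) k) (nth i t k)).
  by case: (odd _); [rewrite !expr1 mulN1r scaleN1r | rewrite !expr0 mul1r scale1r].
apply: eq_bigr => k _; rewrite !ffunE !(tnth_nth i) /=; congr (F _ _).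
(* At the last [k], [ordS] wraps around to the first index [i], which is the default value of
   [nth]. *)
have [kr|] := ltnP k r; first by rewrite modn_small.
rewrite leq_eqVlt ltnNge -ltnS ltn_ord orbF => /eqP <-.
by rewrite modnn [RHS]nth_default ?size_tuple.
Qed.

End CyclicWords.

(** * Center and Harish-Chandra map *)

Lemma mulrDD_cross (A : pzRingType) (a b c d : A) :
  (a + b) * (c + d) = a * c + b * d + (a * d + b * c).
Proof. by rewrite mulrDl !mulrDr [b * c + _]addrC addrACA. Qed.

Lemma supercommM (A : pzRingType) (a b c : bool) (u v w : A) :
  u * w = (-1) ^+ (a && c) * (w * u) -> v * w = (-1) ^+ (b && c) * (w * v) ->
  u * v * w = (-1) ^+ ((a (+) b) && c) * (w * (u * v)).
Proof.
move=> uw vw; rewrite -mulrA vw [LHS]mulrA (commr_sign u) -mulrA [u * _]mulrA uw.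
by rewrite !mulrA -signr_addb; congr (_ ^+ _ * _ * _ * _); case: a b c {uw vw} => [] [] [].
Qed.

Lemma commD_even (A : pzRingType) (y z u : A) :
  y * u = (-1) ^+ (false && false) * (u * y) ->
  z * u = (-1) ^+ (true && false) * (u * z) -> (y + z) * u = u * (y + z).
Proof. by rewrite /= expr0 !mul1r mulrDl mulrDr => -> ->. Qed.

Lemma commrZ (K : fieldType) (A : algType K) (c : K) (x y : A) :
  GRing.comm x y -> GRing.comm x (c *: y).
Proof. by rewrite /GRing.comm -scalerAl -scalerAr => ->. Qed.

Section SuperCenter.
Variables (K : fieldType) (N : nat).
Notation U := (Uq K N).
Notation F := (@Fgen K N).
Implicit Types (i j k m : 'I_(N + N)) (u v w z : U) (a b : bool).

Lemma Uparity_F i j : Uparity (par i (+) par j) (F i j).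
Proof. by apply: Uparity_iota; rewrite vsval_F; exact: Fmx_homogeneous. Qed.

Lemma Uparity0 a : Uparity a (0 : U).
Proof.
have <- : Uiota 0 = 0 :> U by exact: linear0.
by apply: Uparity_iota => i j _; rewrite linear0 mxE.
Qed.

Lemma UparityZ a c u : Uparity a u -> Uparity a (c *: u).
Proof.
move=> au; rewrite -[u]mul1r scalerAl -[a]/(false (+) a).
by apply: UparityM => //; exact: Uparity_scalar.
Qed.

Lemma Uparity_sum a (I : Type) (s : seq I) (P : pred I) (g : I -> U) :
  (forall x, P x -> Uparity a (g x)) -> Uparity a (\sum_(x <- s | P x) g x).
Proof. by move=> ag; apply: big_ind => //; [exact: Uparity0 | exact: UparityD]. Qed.

Lemma Uparity_Fpow r i j : Uparity (par i (+) par j) (Fpow F r i j).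
Proof.
elim: r i j => [|r IHr] i j; first exact: Uparity_F.
apply: Uparity_sum => m _; apply: UparityZ.
have -> : par i (+) par j = (par i (+) par m) (+) (par m (+) par j).
  by rewrite addbA addbK.
by apply: UparityM; [exact: Uparity_F | exact: IHr].
Qed.

Lemma homogeneous_central_scalar c : homogeneous_central false (c%:A : U).
Proof.
split=> [|b u _]; first exact: Uparity_scalar.
by rewrite expr0 mul1r -scalerAl -scalerAr mul1r mulr1.
Qed.

Lemma homogeneous_central0 a : homogeneous_central a (0 : U).
Proof. by split=> [|b u _]; [exact: Uparity0 | rewrite !(mul0r, mulr0)]. Qed.

Lemma homogeneous_centralD a u v :
  homogeneous_central a u -> homogeneous_central a v -> homogeneous_central a (u + v).
Proof.
move=> [pu cu] [pv cv]; split=> [|b w bw]; first exact: UparityD.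
by rewrite mulrDl (cu b w bw) (cv b w bw) mulrDr mulrDr.
Qed.

Lemma homogeneous_centralM a b u v :
  homogeneous_central a u -> homogeneous_central b v ->
  homogeneous_central (a (+) b) (u * v).
Proof.
move=> [pu cu] [pv cv]; split=> [|c w cw]; first exact: UparityM.
exact: supercommM (cu c w cw) (cv c w cw).
Qed.

Lemma central_scalar c : central (c%:A : U).
Proof.
exists c%:A, 0; split; last by rewrite addr0.
  exact: homogeneous_central_scalar.
exact: homogeneous_central0.
Qed.

Lemma centralD u v : central u -> central v -> central (u + v).
Proof.
move=> [u0 [u1 [Hu0 Hu1 ->]]] [v0 [v1 [Hv0 Hv1 ->]]].
exists (u0 + v0), (u1 + v1); split; try exact: homogeneous_centralD.
by rewrite addrACA.
Qed.

Lemma centralM u v : central u -> central v -> central (u * v).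
Proof.
move=> [u0 [u1 [Hu0 Hu1 ->]]] [v0 [v1 [Hv0 Hv1 ->]]].
exists (u0 * v0 + u1 * v1), (u0 * v1 + u1 * v0); split.
- apply: homogeneous_centralD; first exact: homogeneous_centralM Hu0 Hv0.
  exact: homogeneous_centralM Hu1 Hv1.
- apply: homogeneous_centralD; first exact: homogeneous_centralM Hu0 Hv1.
  exact: homogeneous_centralM Hu1 Hv0.
exact: mulrDD_cross.
Qed.

Lemma centralZ c u : central u -> central (c *: u).
Proof. by move=> cu; rewrite -[u]mul1r scalerAl; apply: centralM cu; exact: central_scalar. Qed.

Lemma central_even_comm z u : central z -> Uparity false u -> z * u = u * z.
Proof.
move=> [z0 [z1 [[_ c0] [_ c1] ->]]] pu.
exact: commD_even (c0 _ _ pu) (c1 _ _ pu).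
Qed.

Lemma cyclic_eltE r : cyclic_elt K N r.+1 = \sum_i Fpow F r i i.
Proof. by rewrite -cyclic_words. Qed.

(** The element is even, so only plain commutation is required, and this propagates from the
    generators [F i j] to sums and products. *)
Lemma central_cyclic_elt r : central (cyclic_elt K N r.+1).
Proof.
exists (cyclic_elt K N r.+1), 0; split; last by rewrite addr0.
  2: exact: homogeneous_central0.
rewrite cyclic_eltE; split=> [|b u pu].
  by apply: Uparity_sum => i _; rewrite -(addbb (par i)); exact: Uparity_Fpow.
rewrite expr0 mul1r; set C := \sum_i _; change (GRing.comm C u).
elim: pu => {b u} [c|b X _|b u v _ IHu _ IHv|b c u v _ IHu _ IHv].
- by apply: commrZ; exact: commr1.
- apply: (@Uiota_ind _ _ (GRing.comm C)) => [|u v|c i j]; first exact: commr0.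
    exact: commrD.
  by apply: commrZ; apply: esym; exact: (Fpow_trace_comm (@F_bracket K N)).
- exact: commrD.
- exact: commrM.
Qed.

End SuperCenter.

(** * Multiplicativity of the Harish-Chandra relation *)

Section HarishChandra.
Variables (K : fieldType) (N : nat).
Notation U := (Uq K N).
Notation F := (@Fgen K N).
Implicit Types (u v w z : U) (f g : {mpoly K[N]}).

Definition cartan_eval f : U := mmap (in_alg U) (fun i => F (pos i) (pos i)) f.

Lemma HCE z f : HC z f = HCideal (z - cartan_eval f). Proof. by []. Qed.

Lemma cartan_evalM : {morph cartan_eval : f g / f * g}.
Proof.
apply: mmapM_comm => [i j|c x]; first exact: (cartan_comm (@F_bracket K N)).
by apply/commr_sym/commrZ; exact: commr1.
Qed.

Lemma cartan_evalD : {morph cartan_eval : f g / f + g}. Proof. exact: raddfD. Qed.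

Lemma cartan_evalC c : cartan_eval c%:MP = c%:A. Proof. exact: mmapC. Qed.

Lemma Uparity_cartan f : Uparity false (cartan_eval f).
Proof.
elim/mpolyind: f => [|c m f _ _ IHf].
  by have -> : cartan_eval 0 = 0 by [exact: raddf0]; exact: Uparity0.
rewrite cartan_evalD; apply: UparityD IHf.
rewrite /cartan_eval mmapZ mmapX; apply: (@UparityM _ _ false false).
  exact: Uparity_scalar.
have P1 : Uparity false (1 : U) by rewrite -(scale1r 1); exact: Uparity_scalar.
have PM u v : Uparity false u -> Uparity false v -> Uparity false (u * v).
  exact: UparityM.
apply: (big_ind (Uparity false)); [exact: P1 | exact: PM | move=> i _].
elim: (m i) => [|k IHk]; first exact: P1.
rewrite exprS; apply: PM IHk.
by have := Uparity_F K (pos i) (pos i); rewrite addbb.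
Qed.

(** The summand [U n_+] is stable under every left multiplication, which leaves the summand [n_- U]
    to check. *)
Lemma HCidealMl (x : U) :
  (forall (i j : 'I_N) u, (j < i)%N -> HCideal (x * (F (pos i) (pos j) * u))) ->
  (forall (i j : 'I_N) u, (j < i)%N -> HCideal (x * (F (pos i) (neg (pos j)) * u))) ->
  forall u, HCideal u -> HCideal (x * u).
Proof.
move=> x0 x1 u; elim=> {u} [|u v _ IHu _ IHv|i j u ij|i j u ij|i j u ij|i j u ij].
- by rewrite mulr0; exact: HCideal0.
- by rewrite mulrDr; exact: HCidealD.
- exact: x0.
- exact: x1.
- by rewrite mulrA; exact: HCideal_upper0.
- by rewrite mulrA; exact: HCideal_upper1.
Qed.

Lemma HCidealZ c u : HCideal u -> HCideal (c *: u).
Proof.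
move=> Iu; rewrite -[u]mul1r scalerAl; move: u Iu; apply: HCidealMl => i j u ij.
  by rewrite -scalerAl mul1r scalerAr; exact: HCideal_lower0.
by rewrite -scalerAl mul1r scalerAr; exact: HCideal_lower1.
Qed.

Lemma HCidealMl_central z u : central z -> HCideal u -> HCideal (z * u).
Proof.
move=> [z0 [z1 [[_ c0] [_ c1] ->]]] Iu; rewrite mulrDl.
have step a y : (forall b v, Uparity b v -> y * v = (-1) ^+ (a && b) * (v * y)) ->
    HCideal (y * u).
  move=> cy; move: u Iu; apply: HCidealMl => i j u ij.
    rewrite mulrA (cy _ _ (Uparity_F K (pos i) (pos j))) !par_pos andbF expr0 mul1r -mulrA.
    exact: HCideal_lower0.
  rewrite mulrA (cy _ _ (Uparity_F K (pos i) (neg (pos j)))).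
  rewrite -mulrA -[in X in _ * X]mulrA -signr_odd.
  case: (odd _); last by rewrite expr0 mul1r; exact: HCideal_lower1.
  by rewrite expr1 mulN1r -scaleN1r; apply/HCidealZ/HCideal_lower1.
by apply: HCidealD; [exact: step c0 | exact: step c1].
Qed.

(** Each [F_aa] acts on a lowering generator by a weight, so moving past it reproduces the generator
    on the left. *)
Lemma HCidealMl_cartan f u : HCideal u -> HCideal (cartan_eval f * u).
Proof.
pose P x := forall u, HCideal u -> HCideal (x * u).
have P1 : P 1 by move=> v; rewrite mul1r.
have PM x y : P x -> P y -> P (x * y).
  by move=> Px Py v Iv; rewrite -mulrA; apply/Px/Py.
have Ph a : P (F (pos a) (pos a)).
  apply: HCidealMl => i j v ij; rewrite mulrA.
    rewrite (cartan_weight0 (@F_bracket K N)) mulrDl -scalerAl -mulrA.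
    by apply: HCidealD; [|apply: HCidealZ]; exact: HCideal_lower0.
  rewrite (cartan_weight1 (@F_bracket K N)) mulrDl -scalerAl -mulrA.
  by apply: HCidealD; [|apply: HCidealZ]; exact: HCideal_lower1.
suff : P (cartan_eval f) by exact.
elim/mpolyind: f => [|c m f _ _ IHf].
  have -> : cartan_eval 0 = 0 by exact: raddf0.
  by move=> v _; rewrite mul0r; exact: HCideal0.
rewrite cartan_evalD => v Iv; rewrite mulrDl; apply: HCidealD (IHf v Iv).
rewrite /cartan_eval mmapZ mmapX -mulrA -[_ * (_ * _)]scalerAl mul1r.
apply: HCidealZ; suff : P (mmap1 (fun i => F (pos i) (pos i)) m) by exact.
apply: (big_ind P); [exact: P1 | exact: PM | move=> i _].
elim: (m i) => [|k IHk]; first exact: P1.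
by rewrite exprS; exact: PM (Ph i) IHk.
Qed.

Lemma HCD z z' f f' : HC z f -> HC z' f' -> HC (z + z') (f + f').
Proof.
rewrite !HCE => Hz Hz'; rewrite cartan_evalD opprD addrACA.
exact: HCidealD Hz Hz'.
Qed.

Lemma HCscalar c : HC (c%:A : U) c%:MP.
Proof. by rewrite HCE cartan_evalC subrr; exact: HCideal0. Qed.

Lemma HCM z z' f f' : central z -> HC z f -> HC z' f' -> HC (z * z') (f * f').
Proof.
rewrite !HCE => cz Hz Hz'.
(* This splitting uses only left multiplications that preserve the ideal; [z] commutes with
   [cartan_eval f'], which is even. *)
have -> : z * z' - cartan_eval (f * f')
    = z * (z' - cartan_eval f') + cartan_eval f' * (z - cartan_eval f).
  rewrite !mulrBr -(central_even_comm cz (Uparity_cartan f')) -!cartan_evalM.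
  by rewrite [f' * f]mulrC subrKA.
apply: HCidealD; first exact: HCidealMl_central.
exact: HCidealMl_cartan.
Qed.

Lemma HCZ c z f : HC z f -> HC (c *: z) (c *: f).
Proof.
move=> Hz; rewrite -mul_mpolyC -[z]mul1r scalerAl.
by apply: HCM Hz; [exact: central_scalar | exact: HCscalar].
Qed.

Inductive raising_ideal : U -> Prop :=
| raising_ideal0 : raising_ideal 0
| raising_idealD u v : raising_ideal u -> raising_ideal v -> raising_ideal (u + v)
| raising_idealM i j u : (absi i < absi j)%N -> raising_ideal (u * F i j).

Lemma raising_idealMl u v : raising_ideal v -> raising_ideal (u * v).
Proof.
elim=> {v} [|v w _ IHv _ IHw|i j v ij].
- by rewrite mulr0; exact: raising_ideal0.
- by rewrite mulrDr; exact: raising_idealD.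
- by rewrite mulrA; exact: raising_idealM.
Qed.

Lemma raising_ideal_HC u : raising_ideal u -> HCideal u.
Proof.
elim=> {u} [|u v _ IHu _ IHv|i j u].
- exact: HCideal0.
- exact: HCidealD.
case: (indexP i) => a; case: (indexP j) => b ab.
- exact: HCideal_upper0.
- exact: HCideal_upper1.
- by rewrite -F_neg negK; exact: HCideal_upper1.
- by rewrite F_neg; exact: HCideal_upper0.
Qed.

Lemma HC_cyclic_elt n : (2 : K) != 0 ->
  HC (cyclic_elt K N n.*2.+1) (cyclic_poly (fun b => 'X_b) n).
Proof.
move=> two; rewrite HCE cyclic_eltE; apply: raising_ideal_HC.
apply: (trace_even_eval (@F_neg K N) (@F_bracket K N) two).
- exact: raising_ideal0.
- exact: raising_idealD.
- exact: raising_idealMl.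
- by move=> i j ij; rewrite -[F i j]mul1r; exact: raising_idealM.
Qed.

End HarishChandra.

(** * The generic point and polynomial expressions in central elements *)

Lemma rmorph_cyclic_poly (A B : comNzRingType) (h : {rmorphism A -> B}) (N : nat)
    (lam : 'I_N -> A) n :
  h (cyclic_poly lam n) = cyclic_poly (h \o lam) n.
Proof.
have coordE m a : h (cyclic_coord lam m a) = cyclic_coord (h \o lam) m a.
  elim: m a => [|m IHm] a //=.
  rewrite rmorphB !rmorphM rmorphB rmorph1 rmorph_nat rmorph_sum.
  congr (_ * _ - _ * _); first exact: IHm.
  by apply: eq_bigr => b _; exact: IHm.
rewrite /cyclic_poly rmorphM rmorph_nat rmorph_sum.
by congr (_ * _); apply: eq_bigr => b _; exact: coordE.
Qed.

Lemma rmorph_mmap (R S T : comNzRingType) (f : {rmorphism R -> S}) (g : {rmorphism S -> T})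
    n (h : 'I_n -> S) (P : {mpoly R[n]}) :
  g (mmap f h P) = mmap (g \o f) (g \o h) P.
Proof.
rewrite /mmap rmorph_sum; apply: eq_bigr => m _.
rewrite rmorphM rmorph_prod; congr (_ * _).
by apply: eq_bigr => i _; rewrite rmorphXn.
Qed.

Section OneRowPolynomials.
Variables (K : fieldType) (N : nat).

(** At the generic point the [lam i] are distinct and nonzero, as the generating series require;
    injectivity of [tofrac] brings identities back to polynomials. *)
Definition lamF (i : 'I_N) : {fraction {mpoly K[N]}} := FracField.tofrac 'X_i.

Lemma lamF_inj : injective lamF.
Proof.
move=> i j /eqP; rewrite /lamF tofrac_eq => /eqP /(congr1 (fun f => f@_U_(i))).
rewrite !mcoeffX eqxx; case: eqP => [E _|_ /eqP]; last by rewrite oner_eq0.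
have := congr1 (fun m : 'X_{1..N} => m i) E; rewrite !mnm1E eqxx.
by case: eqP => // ->.
Qed.

Lemma lamF_neq0 i : lamF i != 0.
Proof.
rewrite /lamF tofrac_eq0; apply/eqP => /(congr1 (fun f => f@_U_(i))) /eqP.
by rewrite mcoeffX eqxx mcoeff0 oner_eq0.
Qed.

Lemma onerowQE r (q : {mpoly K[N]}) :
  onerowQ r q -> FracField.tofrac q = factorial_schurQ lamF r.
Proof.
case: r => [|r] /=; first by move=> ->; rewrite tofrac1.
move=> ->; congr (_ * _); apply: eq_bigr => i _; congr (_ * _).
  rewrite rmorph_prod; apply: eq_bigr => k _.
  by rewrite rmorphB rmorph_nat.
by apply: eq_bigr => j _; rewrite rmorphD rmorphB.
Qed.

End OneRowPolynomials.

Section Subalgebras.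
Variables (K : fieldType) (N : nat).
Notation U := (Uq K N).
Implicit Types (u v : U).

Lemma subalg_mono (k k' : fieldType) (phi : {rmorphism k -> K}) (phi' : {rmorphism k' -> K})
    (S S' : U -> Prop) :
  (forall c, subalg phi' S' (phi c)%:A) -> (forall u, S u -> subalg phi' S' u) ->
  forall u, subalg phi S u -> subalg phi' S' u.
Proof.
move=> sc SS' u; elim=> {u} [c|u|u v _ IHu _ IHv|u v _ IHu _ IHv].
- exact: sc.
- exact: SS'.
- exact: subalgD.
- exact: subalgM.
Qed.

Lemma subalgZ (S : U -> Prop) c u : subalg (@idfun K) S u -> subalg (@idfun K) S (c *: u).
Proof.
move=> Su; rewrite -[u]mul1r scalerAl; apply: subalgM Su.
exact: (@subalg_scalar _ _ _ (@idfun K)).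
Qed.

Lemma subalg_mmap (k : fieldType) (phi : {rmorphism k -> K}) p (x : nat -> U) (P : {mpoly k[p]}) :
  subalg phi (oddupto p x) (mmap (in_alg U \o phi) (fun i : 'I_p => x i.*2.+1) P).
Proof.
have S1 : subalg phi (oddupto p x) 1.
  by have := subalg_scalar phi (oddupto p x) 1; rewrite rmorph1 scale1r.
have S0 : subalg phi (oddupto p x) 0.
  by have := subalg_scalar phi (oddupto p x) 0; rewrite rmorph0 scale0r.
rewrite /mmap; apply: big_ind => [|u v|m _]; [exact: S0 | exact: subalgD |].
apply: subalgM; first exact: subalg_scalar.
apply: big_ind => [|u v|i _]; [exact: S1 | exact: subalgM |].
elim: (m i) => [|e IHe]; first exact: S1.
by rewrite exprS; apply: subalgM IHe; apply: subalg_gen; exists (i : nat).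
Qed.

(** Being central with a given Harish-Chandra value is compatible with scalars, sums and
    products. *)
Lemma central_HC_mmap (k : fieldType) (phi : {rmorphism k -> K}) p
    (x : 'I_p -> U) (f : 'I_p -> {mpoly K[N]}) (P : {mpoly k[p]}) :
  (forall i, central (x i) /\ HC (x i) (f i)) ->
  central (mmap (in_alg U \o phi) x P)
  /\ HC (mmap (in_alg U \o phi) x P) (mmap (@mpolyC N K \o phi) f P).
Proof.
move=> xf; pose R u g := central u /\ HC u g.
have Rc c : R c%:A c%:MP by split; [exact: central_scalar | exact: HCscalar].
have R1 : R 1 1 by have := Rc 1; rewrite scale1r mpolyC1.
have R0 : R 0 0 by have := Rc 0; rewrite scale0r mpolyC0.
have RD u g v h : R u g -> R v h -> R (u + v) (g + h).
  by move=> [cu Hu] [cv Hv]; split; [exact: centralD | exact: HCD].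
have RM u g v h : R u g -> R v h -> R (u * v) (g * h).
  by move=> [cu Hu] [cv Hv]; split; [exact: centralM | exact: HCM].
change (R (mmap (in_alg U \o phi) x P) (mmap (@mpolyC N K \o phi) f P)).
rewrite /mmap; apply: (big_ind2 R) => [|u g v h|m _]; [exact: R0 | exact: RD |].
apply: (RM); first exact: Rc.
apply: (big_ind2 R) => [|u g v h|i _]; [exact: R1 | exact: RM |].
elim: (m i) => [|e IHe]; first exact: R1.
by rewrite !exprS; apply: RM IHe; exact: xf.
Qed.

End Subalgebras.

(** * From polynomial identities to the center of U(q_N) *)

Lemma scaler_solve (K : fieldType) (V : lmodType K) (n : K) (c d x : V) :
  n != 0 -> c = n *: d + x -> d = n^-1 *: c + (- n^-1) *: x.
Proof. by move=> n0 ->; rewrite scalerDr scalerA mulVf // scale1r scaleNr addrK. Qed.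

Lemma addr_scaleN1_eq (K : fieldType) (V : lmodType K) (d y z : V) :
  d = d + (y + (-1) *: z) -> y = z.
Proof.
move=> E; apply/eqP; rewrite -subr_eq0 -scaleN1r; apply/eqP/(addrI d).
by rewrite -E addr0.
Qed.

Theorem theorem4p2 (R : realType) (N : nat) (hN : (0 < N)%N)
    (D : nat -> Uq R[i] N)
    (hD : forall r : nat, unique (@is_capelli R[i] N r) (D r)) :
  let c := @cyclic_elt R[i] N in
  [/\ (forall p : nat, (0 < p)%N ->
        subalg (@ratr R[i]) (oddupto p D) (D p.*2)),
      (forall p : nat, (0 < p)%N ->
        exists P : {mpoly rat[p.-1]},
          c p.*2.-1 = (p.*2.-1)%:R *: D p.*2.-1
            + mmap (fun q : rat => (ratr q)%:A)
                   (fun k : 'I_p.-1 => D (k.*2.+1)) P)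
    & (forall p : nat, (0 < p)%N ->
        forall u : Uq R[i] N,
          subalg (@idfun R[i]) (oddupto p c) u
          <-> subalg (@idfun R[i]) (oddupto p D) u)].
Proof.
move=> c.
have nat_neq0 n : (n.+1%:R : R[i]) != 0 by rewrite Num.Theory.pnatr_eq0.
(* Adding [z - z'] to [D 0] keeps it central with the same Harish-Chandra value, so the uniqueness
   in [hD] at index [0] forces [z = z']. *)
have HC_inj (z z' : Uq R[i] N) f : central z -> central z' -> HC z f -> HC z' f -> z = z'.
  move=> cz cz' Hz Hz'; have [[cD [q Hq HD]] uniqD] := hD 0.
  have cap : is_capelli 0 (D 0 + (z + (-1) *: z')).
    split; first by apply: centralD cD _; apply: centralD cz _; exact: centralZ.
    exists (q + (f + (-1) *: f)); last by apply: HCD HD _; apply: HCD Hz _; exact: HCZ.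
    by rewrite scaleN1r subrr addr0.
  exact: addr_scaleN1_eq (uniqD _ cap).
have /choice[q Hq] r : exists q, [/\ central (D r), onerowQ r q & HC (D r) q].
  by have [[cD [q qr HD]] _] := hD r; exists q.
pose phi : {rmorphism rat -> {fraction {mpoly R[i][N]}}} :=
  @FracField.tofrac {mpoly R[i][N]} \o (@mpolyC N R[i] \o ratr).
pose D_eval p (P : {mpoly rat[p]}) :=
  mmap (in_alg (Uq R[i] N) \o ratr) (fun k : 'I_p => D k.*2.+1) P.
(* A polynomial witness for the Harish-Chandra value is evaluated at the odd [D]; both central
   elements then share a value and coincide. *)
have lift p (z : Uq R[i] N) f : central z -> HC z f ->
    FracField.tofrac f \in odd_span phi (factorial_schurQ (@lamF R[i] N)) p ->
    exists P : {mpoly rat[p]}, z = D_eval p P.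
  move=> cz Hz /odd_spanP[P E]; exists P.
  have DP k : central (D k.*2.+1) /\ HC (D k.*2.+1) (q k.*2.+1).
    by have [] := Hq k.*2.+1.
  have [cP HP] := central_HC_mmap (@ratr R[i]) P (fun k : 'I_p => DP k).
  suff Ef : f = mmap (@mpolyC N R[i] \o ratr) (fun k : 'I_p => q k.*2.+1) P.
    by rewrite Ef in Hz; exact: HC_inj cz cP Hz HP.
  apply/eqP; rewrite -tofrac_eq E rmorph_mmap; apply/eqP.
  apply: eq_bigr => m _; congr (_ * _); apply: eq_bigr => k _; congr (_ ^+ _).
  by have [_ /onerowQE] := Hq k.*2.+1.
have even p : exists P : {mpoly rat[p]}, D p.*2 = D_eval p P.
  have [cD qD HD] := Hq p.*2; apply: lift cD HD _.
  rewrite (onerowQE qD).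
  have := factorial_schurQ_odd_span phi (@lamF_inj R[i] N) (@lamF_neq0 R[i] N) p.*2.
  by rewrite uphalf_double.
have odd p : exists P : {mpoly rat[p]},
    c p.*2.+1 = p.*2.+1%:R *: D p.*2.+1 + D_eval p P.
  have [cD qD HD] := Hq p.*2.+1.
  have cC : central (c p.*2.+1) by exact: central_cyclic_elt.
  have HC_c := HC_cyclic_elt N p (nat_neq0 1).
  (* Lifting is applied to the difference of the cyclic element and its expected leading term. *)
  have [|P EP] := lift p _ _ (centralD cC (centralZ (- p.*2.+1%:R) cD))
                       (HCD HC_c (HCZ (- p.*2.+1%:R) HD)).
    rewrite rmorphD rmorph_cyclic_poly scaleNr rmorphN scaler_nat rmorphMn -mulr_natl /=.
    rewrite (onerowQE qD).
    have H := cyclic_poly_odd_span phi (@lamF_inj R[i] N) (@lamF_neq0 R[i] N) p.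
    exact: H.
  by exists P; rewrite -EP scaleNr addrCA subrr addr0.
split.
- by move=> p _; have [P ->] := even p; exact: subalg_mmap.
- move=> p p0.
  have Ep : p = p.-1.+1 by rewrite prednK.
  (* With [p = p'.+1] the index [p.*2.-1] is [p'.*2.+1] by conversion. *)
  move: (p.-1) Ep => p' Ep.
  rewrite Ep.
  have [P EP] := odd p'.
  exists P.
  exact EP.
have eval_sub p (S : Uq R[i] N -> Prop) (P : {mpoly rat[p]}) :
    (forall k, (k < p)%N -> subalg (@idfun R[i]) S (D k.*2.+1)) ->
    subalg (@idfun R[i]) S (D_eval p P).
  move=> DS; apply: (subalg_mono (phi := @ratr R[i])) (subalg_mmap _ _ _) => [x|u].
    exact: (@subalg_scalar _ _ _ (@idfun R[i])).
  by move=> [k kp ->]; exact: DS.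
move=> p _ u; split; apply: subalg_mono => [x|{}u [k kp ->]];
  try exact: (@subalg_scalar _ _ _ (@idfun R[i])).
  have [P ->] := odd k; apply: subalgD.
    by apply: subalgZ; apply: subalg_gen; exists k.
  apply: eval_sub => j jk; apply: subalg_gen; exists j => //; exact: ltn_trans kp.
(* The triangular system is solved for [D] by strong induction, dividing by the nonzero coefficient
   [2k + 1]. *)
elim/ltn_ind: k kp => k IHk kp; have [P EP] := odd k.
rewrite (scaler_solve (nat_neq0 k.*2) EP); apply: subalgD; apply: subalgZ.
  by apply: subalg_gen; exists k.
by apply: eval_sub => j jk; apply: IHk => //; exact: ltn_trans kp.
Qed.
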